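(* Let $1<\alpha<2$ and consider the Lévy model with Pareto disorder. For every $\beta>0$ there exists a constant $C>0$ such that for all integers $M,N\ge1$ with $N/2\le M\le2N$, $$\mathbb E\ln Z_{M+N}\ge\mathbb E\ln Z_M+\mathbb E\ln Z_N-C\phi(M+N),\qquad \phi(x)=x^{1-(2-\alpha)/(1+3\alpha)} .$$ Furthermore, $\lim_{N\to\infty}N^{-1}\mathbb E\ln Z_N$ exists and is the limit of $N^{-1}\ln Z_N$ in $L^p$ norm for every $1\le p<\alpha$.
   Context: Lévy model with Pareto disorder: $X$ has density $\frac\alpha2|x|^{-(\alpha+1)}\mathbf 1_{\{|x|\ge1\}}$ and $J=N^{-1/\alpha}X$. For each $N\ge1$, let $(J_{ij})_{1\le i<j\le N}$ be i.i.d. copies of $J$ (whose law depends on $N$), and for $\beta>0$ let $Z_N=\sum_{\sigma\in\{-1,1\}^N}\exp\bigl(\beta\sum_{1\le i<j\le N}J_{ij}\sigma_i\sigma_j\bigr)$. *)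

(* Defs.v *)
From HB Require Import structures.
From mathcomp Require Import all_boot all_order all_algebra.
From mathcomp Require Import all_classical all_reals all_analysis.

Set Implicit Arguments.
Unset Strict Implicit.
Unset Printing Implicit Defensive.

Import Order.TTheory GRing.Theory Num.Theory.
Import numFieldNormedType.Exports.

Local Open Scope classical_set_scope.
Local Open Scope ring_scope.

Definition pareto_pdf (R : realType) (alpha x : R) : R :=
  if 1 <= `|x| then alpha / 2 * `|x| `^ (- (alpha + 1)) else 0.

(* The law of c * X, where X has density pareto_pdf alpha. *)
Definition scaled_pareto_law (R : realType) (alpha c : R) (A : set R) : \bar R :=
  (\int[lebesgue_measure]_(x in [set x : R | A (c * x)%R])
     (pareto_pdf alpha x)%:E)%E.

Definition mutually_independent (d : measure_display) (T : measurableType d)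
    (R : realType) (P : probability T R) (I : finType) (D : {set I})
    (X : I -> {RV P >-> R}) : Prop :=
  forall (F : {set I}) (B : I -> set R),
    F \subset D ->
    (forall i, i \in F -> measurable (B i)) ->
    P (\bigcap_(i in [set` F]) X i @^-1` B i) =
    (\prod_(i in F) P (X i @^-1` B i))%E.

Definition upper_pairs (N : nat) : {set 'I_N * 'I_N} :=
  [set ij : 'I_N * 'I_N | (ij.1 < ij.2)%N]%SET.

(* Only the entries J i j with i < j are constrained (and only these are used
   below). *)
Definition levy_couplings (R : realType) (alpha : R) (N : nat)
    (d : measure_display) (T : measurableType d) (P : probability T R)
    (J : 'I_N -> 'I_N -> {RV P >-> R}) : Prop :=
  (forall i j : 'I_N, (i < j)%N ->
     forall A : set R, measurable A ->
       distribution P (J i j) A =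
       scaled_pareto_law alpha (N%:R `^ (- alpha^-1)) A) /\
  mutually_independent (upper_pairs N) (fun ij => J ij.1 ij.2).

Definition spin (R : realType) (b : bool) : R := (-1) ^+ b.

(* A configuration is encoded by s : {ffun 'I_N -> bool}, standing for
   sigma_i = spin (s i) in {-1, 1}. *)
Definition partition_function (R : realType) (beta : R) (N : nat)
    (J : 'I_N -> 'I_N -> R) : R :=
  \sum_(s : {ffun 'I_N -> bool})
    expR (beta * \sum_(i < N) \sum_(j < N | (i < j)%N)
                   J i j * spin R (s i) * spin R (s j)).

Definition log_partition (R : realType) (beta : R) (N : nat)
    (d : measure_display) (T : measurableType d) (P : probability T R)
    (J : 'I_N -> 'I_N -> {RV P >-> R}) (w : T) : R :=
  ln (partition_function beta (fun i j => J i j w)).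

Definition phi (R : realType) (alpha x : R) : R :=
  x `^ (1 - (2 - alpha) / (1 + 3 * alpha)).

(* Main.v *)
Require Import Defs.
From HB Require Import structures.
From mathcomp Require Import all_boot all_order all_algebra.
From mathcomp Require Import all_classical all_reals all_analysis.
From mathcomp Require Import measurable_realfun ring lra zify.

(** The couplings of a system of size N have, outside a neighbourhood of zero,
    the law 1/N times the measure with density (alpha/2) |x|^(-alpha-1), which
    does not depend on N.  Fix a cutoff eps above the natural scale
    N^(-1/alpha) of all the systems involved.  Since the couplings are
    symmetric, setting those below eps to zero lowers the mean log-partition
    function, by Jensen's inequality over the signs, and lowers it by at most
    the mean of ln cosh over what is dropped, that is by
    O(N eps^(2-alpha)) ([diluted_le_pmean], [pmean_le_diluted]).  What remains
    is a diluted spin glass: each pair is occupied with a probability of order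
    eps^(-alpha)/N, and the jumps have the same law for all sizes.

    For these systems one interpolates linearly between the occupation rates
    of the system of size M + N and those of two decoupled systems of sizes M
    and N.  The derivative is a sum over pairs {i, j} of the rate of change
    times the expected gain from one more symmetric coupling x on {i, j}.  For
    a Gibbs correlation m this gain is
    ln cosh x + (1/2) ln (1 - tanh(x)^2 m^2).  The rates of change form the
    matrix - k u_i u_j, where u sums to zero and k > 0, so the ln cosh terms
    cancel; the entrywise powers of the correlation matrix, hence also
    - ln (1 - t m^2) with t >= 0, are positive semidefinite, so the derivative
    is nonnegative up to the error made by measuring m without removing the
    coupling already on {i, j} ([interpolation_sign],
    [interpolation_increment]).  That error is
    O(eps^(1-2 alpha)) in total, and the choice
    eps = 3 (M + N)^(-1/(1+3 alpha)) makes both errors O(phi(M + N))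
    ([discrete_energy_superadditive]).  Superadditivity with such an error on
    balanced pairs gives the limit of the means ([near_superadditive_cvg]).

    For the convergence in mean of order p, the log-partition function moves
    by at most a constant times |J - J'| when one coupling J is replaced by
    J'.  Averaging the couplings one by one, as for martingale differences,
    gives for 1 < q < alpha a centred moment of order q bounded by
    O(N^2) E|J|^q = O(N^(2 - q/alpha)) ([pmean_concentration]), which is
    o(N^q) when q is close to alpha.

    All of this is done for couplings with finitely many values, where
    expectations are finite sums over configurations and independence is a
    product formula.  Real couplings are rounded towards zero on a mesh of
    which eps is a multiple; the log-partition function is Lipschitz, so
    dominated convergence and Fatou's lemma carry the estimates over.  Only
    the tails of the law of the couplings enter. *)

Set Implicit Arguments.
Unset Strict Implicit.
Unset Printing Implicit Defensive.

Import Order.TTheory GRing.Theory Num.Theory.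
Import numFieldNormedType.Exports.

Local Open Scope classical_set_scope.
Local Open Scope ring_scope.

(** * Expectations under finite product laws *)

Section FiniteProduct.
Variables (R : realType) (I V : finType).
Implicit Types (rho : I -> V -> R) (f g : {ffun I -> V} -> R).

Definition pmean rho f : R :=
  \sum_(x : {ffun I -> V}) (\prod_i rho i (x i)) * f x.

Definition fupd (x : {ffun I -> V}) (e : I) (v : V) : {ffun I -> V} :=
  [ffun i => if i == e then v else x i].

Definition lupd rho (e : I) (tau : V -> R) : I -> V -> R :=
  fun i => if i == e then tau else rho i.

Definition is_law (w : V -> R) := (forall v, 0 <= w v) /\ \sum_v w v = 1.

Lemma fupd_same x e v : fupd x e v e = v.
Proof. by rewrite ffunE eqxx. Qed.

Lemma fupd_other x e v i : i != e -> fupd x e v i = x i.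
Proof. by move=> /negbTE ie; rewrite ffunE ie. Qed.

Lemma fupd_id x e : fupd x e (x e) = x.
Proof. by apply/ffunP => i; rewrite ffunE; case: eqP => [->|]. Qed.

Lemma fupd_fupd x e v v' : fupd (fupd x e v) e v' = fupd x e v'.
Proof. by apply/ffunP => i; rewrite !ffunE; case: (i == e). Qed.

Lemma fupdC x e e' v v' : e != e' ->
  fupd (fupd x e v) e' v' = fupd (fupd x e' v') e v.
Proof.
move=> ee'; apply/ffunP => i; rewrite !ffunE.
by case: eqP => [->|//]; rewrite eq_sym (negbTE ee').
Qed.

Lemma eq_pmean rho f g : f =1 g -> pmean rho f = pmean rho g.
Proof. by move=> fg; apply: eq_bigr => x _; rewrite fg. Qed.

Lemma eq_pmean_law rho rho' f : rho =2 rho' -> pmean rho f = pmean rho' f.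
Proof.
move=> fg; apply: eq_bigr => x _; congr (_ * _).
by apply: eq_bigr => i _; rewrite fg.
Qed.

Lemma pmeanD rho f g : pmean rho (fun x => f x + g x) = pmean rho f + pmean rho g.
Proof. by rewrite /pmean -big_split; apply: eq_bigr => x _; rewrite mulrDr. Qed.

Lemma pmeanZ rho a f : pmean rho (fun x => a * f x) = a * pmean rho f.
Proof. by rewrite /pmean mulr_sumr; apply: eq_bigr => x _; rewrite mulrCA. Qed.

Lemma pmeanB rho f g : pmean rho (fun x => f x - g x) = pmean rho f - pmean rho g.
Proof.
rewrite -[X in _ - X]mul1r -mulNr -pmeanZ -pmeanD.
by apply: eq_pmean => x; rewrite mulN1r.
Qed.

Lemma pmean_sum rho (A : finType) (F : A -> {ffun I -> V} -> R) :
  pmean rho (fun x => \sum_a F a x) = \sum_a pmean rho (F a).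
Proof.
rewrite /pmean exchange_big /=; apply: eq_bigr => x _.
by rewrite mulr_sumr.
Qed.

Lemma prod_law_sum rho : (forall i, \sum_v rho i v = 1) ->
  \sum_(x : {ffun I -> V}) \prod_i rho i (x i) = 1.
Proof.
by move=> h; rewrite -(bigA_distr_bigA rho) big1.
Qed.

Lemma pmean_cst rho a : (forall i, is_law (rho i)) -> pmean rho (fun=> a) = a.
Proof.
move=> h; rewrite /pmean -mulr_suml prod_law_sum ?mul1r// => i.
by case: (h i).
Qed.

Lemma le_pmean rho f g : (forall i, is_law (rho i)) ->
  (forall x, f x <= g x) -> pmean rho f <= pmean rho g.
Proof.
move=> h fg; apply: ler_sum => x _; apply: ler_wpM2l => //.
by apply: prodr_ge0 => i _; case: (h i).
Qed.

Lemma pmean_ge0 rho f : (forall i, is_law (rho i)) ->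
  (forall x, 0 <= f x) -> 0 <= pmean rho f.
Proof. by move=> h f0; rewrite -(pmean_cst 0 h); exact: le_pmean. Qed.

(** Changing the law of one coordinate amounts to resampling it: the pairs
    (x, v) are permuted by exchanging the e-th coordinate of x with v. *)
Lemma pmean_resample rho e tau f : \sum_v rho e v = 1 ->
  pmean (lupd rho e tau) f =
  pmean rho (fun x => \sum_v tau v * f (fupd x e v)).
Proof.
move=> h1.
pose q (x : {ffun I -> V}) := \prod_(i | i != e) rho i (x i).
have qU x v : q (fupd x e v) = q x.
  by apply: eq_bigr => i ie; rewrite fupd_other.
transitivity (\sum_(p : {ffun I -> V} * V) q p.1 * rho e p.2 * (tau (p.1 e) * f p.1)).
  rewrite -(pair_bigA _ (fun x v => q x * rho e v * (tau (x e) * f x)))/=.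
  apply: eq_bigr => x _; rewrite -mulr_suml -mulr_sumr h1 mulr1.
  rewrite (bigD1 e)//= {1}/lupd eqxx.
  rewrite (eq_bigr (fun i => rho i (x i))) => [|i /negbTE ie].
    by rewrite -/(q x); ring.
  by rewrite /lupd ie.
have sw : {on predT, bijective
    (fun p : {ffun I -> V} * V => (fupd p.1 e p.2, p.1 e))}.
  exists (fun p : {ffun I -> V} * V => (fupd p.1 e p.2, p.1 e)) => -[x v] _ /=;
    by rewrite fupd_fupd fupd_same fupd_id.
rewrite (reindex _ sw) /= -(pair_bigA _ (fun x v =>
  q (fupd x e v) * rho e (x e) * (tau (fupd x e v e) * f (fupd x e v))))/=.
apply: eq_bigr => x _; rewrite mulr_sumr; apply: eq_bigr => v _.
by rewrite qU fupd_same (bigD1 e)//= [q x * _]mulrC.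
Qed.

Lemma pmean_average rho e f : \sum_v rho e v = 1 ->
  pmean rho f = pmean rho (fun x => \sum_v rho e v * f (fupd x e v)).
Proof.
move=> h1; rewrite -pmean_resample//; apply: eq_pmean_law => i v.
by rewrite /lupd; case: eqP => // ->.
Qed.

(** Lindeberg replacement: the laws are exchanged one coordinate at a time,
    the others being arbitrary mixtures of old and new. *)
Lemma pmean_replace rho rho' f (delta : I -> R) :
  (forall i, is_law (rho i)) -> (forall i, is_law (rho' i)) ->
  (forall e x, \sum_v rho' e v * f (fupd x e v) <=
               \sum_v rho e v * f (fupd x e v) + delta e) ->
  pmean rho' f <= pmean rho f + \sum_e delta e.
Proof.
move=> h h' hd.
pose mix (s : seq I) := fun i => if i \in s then rho' i else rho i.
have hmix s i : is_law (mix s i) by rewrite /mix; case: ifP.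
suff H s : uniq s -> pmean (mix s) f <= pmean rho f + \sum_(e <- s) delta e.
  have := H (enum I) (enum_uniq I); rewrite big_enum/=.
  rewrite (@eq_pmean_law (mix (enum I)) rho')// => i v.
  by rewrite /mix mem_enum.
elim: s => [_|e s IH /= /andP[es us]].
  by rewrite big_nil addr0 (@eq_pmean_law _ rho).
have -> : pmean (mix (e :: s)) f = pmean (lupd (mix s) e (rho' e)) f.
  apply: eq_pmean_law => i v; rewrite /mix /lupd inE.
  by case: eqP => // ->.
have s1 t : \sum_v mix s t v = 1 by case: (hmix s t).
rewrite pmean_resample// big_cons.
apply: (@le_trans _ _ (pmean (mix s) f + delta e)).
  rewrite [X in _ <= X + _](pmean_average (e := e))//.
  rewrite -(pmean_cst (delta e) (hmix s)) -pmeanD.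
  apply: le_pmean => // x; apply: le_trans (hd e x) _.
  by rewrite lerD2r; apply: ler_sum => v _; rewrite /mix (negbTE es).
by rewrite [delta e + _]addrC addrA lerD2r IH.
Qed.

End FiniteProduct.

(** Summing over the configurations that restrict to a given one factorises
    into the sums over single coordinates, and the coordinates outside the
    image of io contribute a factor 1. *)
Lemma pmean_marginal (R : realType) (I I' V : finType) (io : I' -> I)
    (rho : I -> V -> R) (f : {ffun I' -> V} -> R) :
  injective io -> (forall i, \sum_v rho i v = 1) ->
  pmean rho (fun x => f [ffun i => x (io i)]) = pmean (fun i => rho (io i)) f.
Proof.
move=> ioI h1; rewrite /pmean.
rewrite (partition_big (fun x : {ffun I -> V} => [ffun i => x (io i)]) predT)//=.
apply: eq_bigr => y _.
under eq_bigr => x /eqP -> do [].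
rewrite -mulr_suml; congr (_ * _).
pose ok (i : I) (v : V) := [forall i', (io i' == i) ==> (v == y i')].
transitivity (\sum_(x : {ffun I -> V}) \prod_i (if ok i (x i) then rho i (x i) else 0)).
  rewrite big_mkcond; apply: eq_bigr => x _.
  have [/eqP xy|xy] := ifPn.
    apply: eq_bigr => i _; case: ifPn => // /forallPn[i'].
    by rewrite negb_imply => /andP[/eqP <-]; rewrite -xy ffunE eqxx.
  have [i' hi'] : exists i', x (io i') != y i'.
    apply/existsP; apply: contraNT xy => /existsPn h.
    by apply/eqP/ffunP => i; rewrite ffunE; have := h i; rewrite negbK => /eqP.
  rewrite (bigD1 (io i'))//=; case: ifPn => [/forallP/(_ i')|]; last by rewrite mul0r.
  by rewrite eqxx /= (negbTE hi').
rewrite -(bigA_distr_bigA (fun i v => if ok i v then rho i v else 0)).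
rewrite (bigID (fun i => i \in codom io))/= [X in _ * X]big1 ?mulr1; last first.
  move=> i hi; rewrite -[RHS](h1 i); apply: eq_bigr => v _.
  case: ifPn => // /forallPn[i']; rewrite negb_imply => /andP[/eqP ii' _].
  by move: hi; rewrite -ii' codom_f.
transitivity (\prod_(i in io @: [set: I']%SET) \sum_v (if ok i v then rho i v else 0)).
  by apply: eq_bigl => i; apply/codomP/imsetP => [[i' ->]|[i' _ ->]]; exists i'.
rewrite big_imset/=; last by move=> i j _ _; exact: ioI.
under eq_bigl do rewrite inE.
apply: eq_bigr => i' _; rewrite (bigD1 (y i'))//= big1 ?addr0.
  case: ifPn => // /forallPn[j]; rewrite negb_imply => /andP[/eqP/ioI ->].
  by rewrite eqxx.
move=> v vy; case: ifPn => // /forallP/(_ i').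
by rewrite eqxx /= (negbTE vy).
Qed.

(** * Derivative of a product expectation along a segment of laws *)

Lemma deriv_prod_uniq (R : comNzRingType) (I : eqType) (s : seq I) (p : I -> {poly R}) :
  uniq s -> (\prod_(i <- s) p i)^`() =
  \sum_(e <- s) (p e)^`() * \prod_(i <- s | i != e) p i.
Proof.
elim: s => [|a s IH /= /andP[as_ us]]; first by rewrite !big_nil derivC.
rewrite !big_cons derivM IH// eqxx /=; congr (_ * _ + _).
  rewrite [LHS]big_seq [RHS]big_seq_cond; apply: eq_bigl => i.
  by case: (boolP (i \in s)) => //= /(memPn as_) ->.
rewrite mulr_sumr; apply: eq_big_seq => e es.
by rewrite big_cons eq_sym (memPn as_)// mulrCA.
Qed.

(** The multi-affine dependence on the laws makes the derivative a sum over
    coordinates, each coordinate contributing the signed law b e in its own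
    place; the mean value theorem turns a bound on it into an increment. *)
Lemma pmean_segment (R : realType) (I V : finType) (a b : I -> V -> R)
    (f : {ffun I -> V} -> R) (K : R) :
  (forall t : R, 0 <= t <= 1 ->
     K <= \sum_e pmean (lupd (fun i v => a i v + t * b i v) e (b e)) f) ->
  K <= pmean (fun i v => a i v + b i v) f - pmean a f.
Proof.
move=> h.
pose P : {poly R} := \sum_(x : {ffun I -> V})
  (\prod_i ((a i (x i))%:P + (b i (x i))%:P * 'X)) * (f x)%:P.
have hP t : P.[t] = pmean (fun i v => a i v + t * b i v) f.
  rewrite /P horner_sum; apply: eq_bigr => x _.
  rewrite hornerM hornerC horner_prod; congr (_ * _).
  by apply: eq_bigr => i _; rewrite !hornerE mulrC.
have hP' t : P^`().[t] =
    \sum_e pmean (lupd (fun i v => a i v + t * b i v) e (b e)) f.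
  rewrite /P linear_sum horner_sum /pmean exchange_big /=.
  apply: eq_bigr => x _; rewrite derivM derivC mulr0 addr0.
  rewrite deriv_prod_uniq ?index_enum_uniq// hornerM hornerC -mulr_suml horner_sum.
  congr (_ * _); apply: eq_bigr => e _.
  rewrite [in RHS](bigD1 e)//= {1}/lupd eqxx hornerM horner_prod; congr (_ * _).
    by rewrite derivD derivC add0r derivM derivC derivX mul0r add0r mulr1 hornerC.
  by apply: eq_bigr => i /negbTE ie; rewrite /lupd ie !hornerE mulrC.
have dP y : y \in `](0 : R), 1[ -> is_derive y 1 (horner P) (P^`()).[y].
  by move=> _; exact: is_derive_poly.
have cP : {within `[(0 : R), 1], continuous (horner P)}.
  by apply: continuous_subspaceT; exact: continuous_horner.
have [c c01 hc] := MVT (@ltr01 R) dP cP.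
have <- : P.[1] - P.[0] = pmean (fun i v => a i v + b i v) f - pmean a f.
  rewrite !hP; congr (_ - _); apply: eq_pmean_law => i v; first by rewrite mul1r.
  by rewrite mul0r addr0.
rewrite hc subr0 mulr1 hP'; apply: h; move: c01; rewrite in_itv /= => /andP[c0 c1].
by rewrite !ltW.
Qed.

(** * Hyperbolic functions and the symmetrised effect of one coupling *)

Section Hyperbolic.
Variable R : realType.
Implicit Types y m t x : R.

Definition cosh y : R := (expR y + expR (- y)) / 2.
Definition sinh y : R := (expR y - expR (- y)) / 2.

Lemma cosh2Bsinh2 y : cosh y ^+ 2 - sinh y ^+ 2 = 1.
Proof. by have := expRxMexpNx_1 y; rewrite /cosh /sinh; nra. Qed.

Lemma coshN y : cosh (- y) = cosh y.
Proof. by rewrite /cosh opprK addrC. Qed.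

Lemma sinhN y : sinh (- y) = - sinh y.
Proof. by rewrite /sinh opprK; lra. Qed.

Lemma cosh0 : cosh 0 = 1.
Proof. by rewrite /cosh oppr0 expR0; lra. Qed.

Lemma sinh0 : sinh 0 = 0.
Proof. by rewrite /sinh oppr0 expR0; lra. Qed.

Lemma cosh_gt0 y : 0 < cosh y.
Proof. by have := expR_gt0 y; have := expR_gt0 (- y); rewrite /cosh; lra. Qed.

Lemma cosh_ge1 y : 1 <= cosh y.
Proof.
by have := expR_ge1Dx y; have := expR_ge1Dx (- y); rewrite /cosh; lra.
Qed.

Lemma cosh_sinh_gt0 y m : `|m| <= 1 -> 0 < cosh y + m * sinh y.
Proof.
rewrite ler_norml => /andP[m1 m2].
have := expR_gt0 y; have := expR_gt0 (- y); rewrite /cosh /sinh; nra.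
Qed.

Lemma ln_cosh_ge0 y : 0 <= ln (cosh y).
Proof. exact/ln_ge0/cosh_ge1. Qed.

Lemma ln_cosh_le_norm y : ln (cosh y) <= `|y|.
Proof.
rewrite -[leRHS]expRK ler_ln ?posrE ?cosh_gt0 ?expR_gt0//.
have h1 : expR y <= expR `|y| by rewrite ler_expR ler_norm.
have h2 : expR (- y) <= expR `|y| by rewrite ler_expR -normrN ler_norm.
by rewrite /cosh; lra.
Qed.

Lemma ln_cosh_le_sqr y : ln (cosh y) <= 2 * y ^+ 2.
Proof.
have [y2|y2] := leP 2^-1 `|y|.
  apply: le_trans (ln_cosh_le_norm y) _.
  have -> : y ^+ 2 = `|y| * `|y| by rewrite -expr2 real_normK ?num_real.
  by move: y2; set z := `|y| => y2; nra.
rewrite -[leRHS]expRK ler_ln ?posrE ?cosh_gt0 ?expR_gt0//.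
apply: le_trans (expR_ge1Dx _).
have b (z : R) : `|z| < 2^-1 -> expR z <= 1 + z + 2 * z ^+ 2.
  rewrite ltr_norml => /andP[z1 z2].
  have := expR_ge1Dx (- z); have := expRxMexpNx_1 z; have := expR_gt0 z.
  set a := expR z; set c := expR (- z) => a0 ac c1.
  have h : a * (1 - z) <= 1 by rewrite -ac; apply: ler_wpM2l; lra.
  have h2 : 1 <= (1 + z + 2 * z ^+ 2) * (1 - z).
    have -> : (1 + z + 2 * z ^+ 2) * (1 - z) = 1 + z ^+ 2 * (1 - 2 * z) by ring.
    by rewrite lerDl mulr_ge0 ?sqr_ge0//; lra.
  rewrite -(@ler_pM2r _ (1 - z)); last lra.
  exact: le_trans h h2.
have := b _ y2; have := b (- y); rewrite normrN => /(_ y2).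
by rewrite sqrrN /cosh; lra.
Qed.

(** The gain in log-partition from a symmetric coupling of strength y on a
    bond of correlation m. *)
Definition bond_gain y m : R :=
  (ln (cosh y + m * sinh y) + ln (cosh y - m * sinh y)) / 2.

Lemma bond_gainE y m : `|m| <= 1 ->
  bond_gain y m =
  ln (cosh y) + ln (1 - (sinh y / cosh y) ^+ 2 * m ^+ 2) / 2.
Proof.
move=> m1; have c0 := cosh_gt0 y.
have p1 := cosh_sinh_gt0 y m1.
have p2 : 0 < cosh y - m * sinh y.
  by rewrite -mulNr; apply: cosh_sinh_gt0; rewrite normrN.
have e : (cosh y + m * sinh y) * (cosh y - m * sinh y) =
    cosh y * cosh y * (1 - (sinh y / cosh y) ^+ 2 * m ^+ 2).
  by field; rewrite gt_eqF.
have p3 : 0 < 1 - (sinh y / cosh y) ^+ 2 * m ^+ 2.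
  by rewrite -(pmulr_rgt0 _ (mulr_gt0 c0 c0)) -e mulr_gt0.
have cc0 := mulr_gt0 c0 c0.
rewrite /bond_gain -lnM ?posrE// e [ln (_ * (1 - _))]lnM ?posrE//.
rewrite lnM ?posrE//; lra.
Qed.

Lemma tanh2_bounds y : 0 <= (sinh y / cosh y) ^+ 2 < 1.
Proof.
have c0 := cosh_gt0 y.
rewrite sqr_ge0 /= expr_div_n ltr_pdivrMr ?exprn_gt0// mul1r.
by have := cosh2Bsinh2 y; lra.
Qed.

Lemma bond_gain_le y m : `|m| <= 1 -> bond_gain y m <= ln (cosh y).
Proof.
move=> m1; rewrite bond_gainE// gerDl.
suff : ln (1 - (sinh y / cosh y) ^+ 2 * m ^+ 2) <= 0 by lra.
by apply: ln_le0; rewrite gerBl mulr_ge0// ?sqr_ge0.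
Qed.

Lemma bond_gain_ge0 y m : `|m| <= 1 -> 0 <= bond_gain y m.
Proof.
move=> m1; have p1 := cosh_sinh_gt0 y m1.
have p2 : 0 < cosh y - m * sinh y.
  by rewrite -mulNr; apply: cosh_sinh_gt0; rewrite normrN.
rewrite /bond_gain -lnM ?posrE// divr_ge0//; apply: ln_ge0.
have -> : (cosh y + m * sinh y) * (cosh y - m * sinh y) =
  cosh y ^+ 2 - sinh y ^+ 2 + (1 - m ^+ 2) * sinh y ^+ 2 by ring.
rewrite cosh2Bsinh2 lerDl mulr_ge0 ?sqr_ge0// subr_ge0.
by rewrite -real_normK ?num_real// expr_le1.
Qed.

Lemma bond_gain1 y : bond_gain y 1 = 0.
Proof.
have p1 := @cosh_sinh_gt0 y 1; have p2 := @cosh_sinh_gt0 y (- 1).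
rewrite /bond_gain -lnM ?posrE ?p1 ?normr1//; last first.
  by rewrite -mulNr p2// normrN normr1.
by rewrite mul1r [(_ + _) * _]mulrC -subr_sqr cosh2Bsinh2 ln1 mul0r.
Qed.

End Hyperbolic.

(** * Positive semidefiniteness of the logarithmic kernel *)

Section LogKernel.
Variable R : realType.

(** The derivative of the remainder of the series of - ln (1 - x) is the tail
    x ^ K / (1 - x) of the geometric series. *)
Lemma ln_series_bound (x r : R) K : 0 <= x <= r -> r < 1 ->
  `| - ln (1 - x) - \sum_(k < K) x ^+ k.+1 / k.+1%:R | <= r ^+ K / (1 - r).
Proof.
move=> /andP[x0 xr] r1.
pose P : {poly R} := \sum_(k < K) (k.+1%:R^-1)%:P * 'X^(k.+1).
have hP y : P.[y] = \sum_(k < K) y ^+ k.+1 / k.+1%:R.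
  rewrite horner_sum; apply: eq_bigr => k _.
  by rewrite hornerM hornerC hornerXn mulrC.
have hP' y : P^`().[y] = \sum_(k < K) y ^+ k.
  rewrite /P linear_sum horner_sum; apply: eq_bigr => k _.
  rewrite /= derivM derivC mul0r add0r derivXn hornerM hornerC hornerMn hornerXn /=.
  by rewrite -[y ^+ k *+ _]mulr_natr mulrCA mulVf ?mulr1// pnatr_eq0.
have geo (y : R) : y < 1 -> (1 - y)^-1 - \sum_(k < K) y ^+ k = y ^+ K / (1 - y).
  move=> y1; have ny : 1 - y != 0 by rewrite gt_eqF// subr_gt0.
  apply: (mulIf ny); rewrite divfK// mulrBl mulVf//.
  by rewrite -(opprB y 1) mulrN opprK mulrC -subrX1; ring.
have [->|xn0] := eqVneq x 0.
  rewrite subr0 ln1 oppr0 big1 ?subr0 ?normr0.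
    by rewrite divr_ge0 ?exprn_ge0//; lra.
  by move=> k _; rewrite expr0n mul0r.
have xp : 0 < x by rewrite lt_def xn0.
pose f (y : R) := - ln (1 - y) - P.[y].
pose df (y : R) := (1 - y)^-1 - P^`().[y].
have df1 (y : R) : y < 1 -> is_derive y 1 f (df y).
  move=> y1; have y1' : 0 < 1 - y by lra.
  have d1 : is_derive (1 - y) 1 (@ln R) (1 - y)^-1 by exact: is_derive1_ln.
  have d2 : is_derive y (1 : R) (cst 1 - id) (0 - 1 : R) by exact: is_deriveB.
  have d3 := @is_derive1_comp R (@ln R) (cst 1 - id) y _ _ d1 d2.
  have d4 := is_deriveB (is_deriveN d3) (is_derive_poly P y).
  have -> : df y = - ((1 - y)^-1 * (0 - 1)) - P^`().[y].
    by rewrite /df sub0r mulrN1 opprK.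
  exact: d4.
have dP y : y \in `](0 : R), x[ -> is_derive y 1 f (df y).
  by rewrite in_itv /= => /andP[_ yx]; apply: df1; lra.
have cP : {within `[(0 : R), x], continuous f}.
  apply: derivable_within_continuous => y; rewrite in_itv /= => /andP[_ yx].
  by apply: ex_derive; apply: df1; lra.
have f0 : f 0 = 0.
  rewrite /f hP subr0 ln1 oppr0 big1 ?subr0// => k _.
  by rewrite expr0n mul0r.
have [c] := MVT xp dP cP; rewrite in_itv /= f0 !subr0 => /andP[c0 cx].
rewrite -hP -/(f x) => ->.
have c1 : c < 1 by lra.
rewrite /df hP' geo// ger0_norm; last first.
  rewrite mulr_ge0 ?divr_ge0 ?exprn_ge0//; lra.
rewrite -[leRHS]mulr1; apply: ler_pM; rewrite ?divr_ge0 ?exprn_ge0//; try lra.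
apply: ler_pM; rewrite ?exprn_ge0 ?invr_ge0//; try lra.
  by apply: lerXn2r; rewrite ?nnegrE; lra.
by rewrite lef_pV2 ?posrE; lra.
Qed.

Variables (S A : finType) (p : S -> R) (sig : A -> S -> R).
Hypothesis p0 : forall s, 0 <= p s.

Definition overlap i j : R := \sum_s p s * (sig i s * sig j s).

(** Entrywise powers of a Gram matrix are Gram matrices of tensor powers;
    one factor is absorbed into the test vector at each step. *)
Lemma overlap_exp_psd k (u : A -> R) :
  0 <= \sum_i \sum_j u i * u j * overlap i j ^+ k.
Proof.
elim: k u => [|k IH] u.
  have -> : \sum_i \sum_j u i * u j * overlap i j ^+ 0 = (\sum_i u i) ^+ 2.
    rewrite expr2 mulr_suml; apply: eq_bigr => i _; rewrite mulr_sumr.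
    by apply: eq_bigr => j _; rewrite expr0 mulr1.
  exact: sqr_ge0.
have -> : \sum_i \sum_j u i * u j * overlap i j ^+ k.+1 =
    \sum_s p s * \sum_i \sum_j (u i * sig i s) * (u j * sig j s) * overlap i j ^+ k.
  under [RHS]eq_bigr do rewrite mulr_sumr.
  rewrite [RHS]exchange_big /=; apply: eq_bigr => i _.
  under [RHS]eq_bigr do rewrite mulr_sumr.
  rewrite [RHS]exchange_big /=; apply: eq_bigr => j _.
  rewrite exprS {1}/overlap mulrA mulr_sumr mulr_suml; apply: eq_bigr => s _.
  ring.
by apply: sumr_ge0 => s _; rewrite mulr_ge0.
Qed.

(** The series of - ln (1 - x) has nonnegative coefficients, so the kernel is a
    limit of nonnegative combinations of even powers of the overlap. *)
Lemma log_kernel_psd (t : R) (u : A -> R) : 0 <= t < 1 ->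
  (forall i j, `|overlap i j| <= 1) ->
  0 <= \sum_i \sum_j u i * u j * - ln (1 - t * overlap i j ^+ 2).
Proof.
move=> /andP[t0 t1] m1.
pose x i j := t * overlap i j ^+ 2.
have x0 i j : 0 <= x i j <= t.
  rewrite mulr_ge0 ?sqr_ge0//= ler_piMr// -real_normK ?num_real//.
  by rewrite expr_le1.
pose Q K := \sum_i \sum_j u i * u j * \sum_(k < K) x i j ^+ k.+1 / k.+1%:R.
have Q0 K : 0 <= Q K.
  have -> : Q K = \sum_(k < K) t ^+ k.+1 / k.+1%:R *
      \sum_i \sum_j u i * u j * overlap i j ^+ (2 * k.+1).
    under [RHS]eq_bigr do rewrite mulr_sumr.
    rewrite [RHS]exchange_big /=; apply: eq_bigr => i _.
    under [RHS]eq_bigr do rewrite mulr_sumr.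
    rewrite [RHS]exchange_big /=; apply: eq_bigr => j _.
    rewrite mulr_sumr; apply: eq_bigr => k _.
    rewrite /x exprMn -exprM; ring.
  apply: sumr_ge0 => k _; rewrite mulr_ge0 ?overlap_exp_psd//.
  by rewrite divr_ge0 ?exprn_ge0.
pose B := \sum_i \sum_j `|u i * u j| / (1 - t).
have B0 : 0 <= B.
  apply: sumr_ge0 => i _; apply: sumr_ge0 => j _; rewrite divr_ge0//; lra.
have QB K : Q K - B * t ^+ K <= \sum_i \sum_j u i * u j * - ln (1 - x i j).
  rewrite lerBlDr /Q /B -lerBlDl mulr_suml -sumrB; apply: ler_sum => i _.
  rewrite mulr_suml -sumrB; apply: ler_sum => j _.
  rewrite -mulrBr; apply: le_trans (ler_norm _) _; rewrite normrM.
  rewrite -mulrA ler_wpM2l// [_^-1 * _]mulrC distrC.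
  exact: ln_series_bound.
apply/ler_addgt0Pr => e e0.
have [K hK] : exists K, B * t ^+ K <= e.
  have /cvgrPdist_le/(_ _ e0)[K _ /(_ K (leqnn K))] :
      (fun K => B * t ^+ K) @ \oo --> B * 0.
    by apply: cvgMr; apply: cvg_expr; rewrite ger0_norm.
  rewrite mulr0 sub0r normrN /= => h; exists K.
  exact: le_trans (ler_norm _) h.
by have := QB K; have := Q0 K; rewrite /x; lra.
Qed.

End LogKernel.

(** * Spin systems with couplings from a finite set of values *)

Section SpinSystem.
Variables (R : realType) (S I V : finType) (chi : I -> S -> R) (val : V -> R).
Variables (v0 : V) (s0 : S).
Hypothesis chi2 : forall e s, chi e s ^+ 2 = 1.
Hypothesis val0 : val v0 = 0.
Implicit Types (x : {ffun I -> V}) (e : I).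

Definition boltzmann (J : I -> R) (s : S) : R := expR (\sum_e J e * chi e s).
Definition Zfun (J : I -> R) : R := \sum_s boltzmann J s.
Definition gibbs (J : I -> R) s : R := boltzmann J s / Zfun J.
Definition corr (J : I -> R) e : R := \sum_s gibbs J s * chi e s.
Definition logZ x : R := ln (Zfun (fun e => val (x e))).

Lemma Zfun_gt0 J : 0 < Zfun J.
Proof.
rewrite /Zfun (bigD1 s0)//= ltr_pwDl ?expR_gt0// sumr_ge0// => s _.
exact: expR_ge0.
Qed.

Lemma gibbs_ge0 J s : 0 <= gibbs J s.
Proof. by rewrite divr_ge0 ?expR_ge0// ltW ?Zfun_gt0. Qed.

Lemma gibbs_sum J : \sum_s gibbs J s = 1.
Proof. by rewrite -mulr_suml divff// gt_eqF// Zfun_gt0. Qed.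

Lemma chi_norm e s : `|chi e s| = 1.
Proof.
by have /eqP := chi2 e s; rewrite sqrf_eq1 => /orP[]/eqP->; rewrite ?normrN normr1.
Qed.

Lemma gibbs_avg_le1 J (f : S -> R) : (forall s, `|f s| <= 1) ->
  `|\sum_s gibbs J s * f s| <= 1.
Proof.
move=> f1; apply: le_trans (ler_norm_sum _ _ _) _.
rewrite -(gibbs_sum J); apply: ler_sum => s _.
by rewrite normrM (ger0_norm (gibbs_ge0 _ _)) ler_piMr ?gibbs_ge0.
Qed.

Lemma corr_le1 J e : `|corr J e| <= 1.
Proof. by apply: gibbs_avg_le1 => s; rewrite chi_norm. Qed.

Lemma expR_chi (y : R) e s : expR (y * chi e s) = cosh y + chi e s * sinh y.
Proof.
have /eqP := chi2 e s; rewrite sqrf_eq1 => /orP[]/eqP->.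
  by rewrite mulr1 mul1r /cosh /sinh; lra.
by rewrite mulrN1 mulN1r /cosh /sinh; lra.
Qed.

(** Each Boltzmann weight changes by a factor at most the exponential of the
    sum of the changes of the couplings. *)
Lemma ln_Zfun_lipschitz J J' : `|ln (Zfun J) - ln (Zfun J')| <= \sum_e `|J e - J' e|.
Proof.
have half J1 J2 : ln (Zfun J1) <= ln (Zfun J2) + \sum_e `|J1 e - J2 e|.
  rewrite -[X in _ <= _ + X]expRK -lnM ?posrE ?Zfun_gt0 ?expR_gt0//.
  rewrite ler_ln ?posrE ?mulr_gt0 ?Zfun_gt0 ?expR_gt0// /Zfun mulr_suml.
  apply: ler_sum => s _; rewrite /boltzmann -expRD ler_expR -big_split /=.
  apply: ler_sum => e _; rewrite -lerBlDl -mulrBl.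
  by apply: le_trans (ler_norm _) _; rewrite normrM chi_norm mulr1.
have h1 := half J J'; have := half J' J.
rewrite (eq_bigr (fun e => `|J e - J' e|)); last by move=> e _; rewrite distrC.
by rewrite ler_norml => h2; apply/andP; split; lra.
Qed.

Lemma logZ_lipschitz x e v : `|logZ (fupd x e v) - logZ x| <= `|val v| + `|val (x e)|.
Proof.
apply: le_trans (ln_Zfun_lipschitz _ _) _.
rewrite (bigD1 e)//= fupd_same big1 ?addr0; first exact: ler_normB.
by move=> i ie; rewrite fupd_other// subrr normr0.
Qed.

Local Notation vals x := (fun i => val (x i)).

(** The cavity correlation: not depending on the coupling of e, it makes the
    effect of that coupling on the log-partition explicit. *)
Definition cavity_corr x e : R := corr (vals (fupd x e v0)) e.

Lemma logZ_fupd x e v :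
  logZ (fupd x e v) = logZ (fupd x e v0) +
    ln (cosh (val v) + cavity_corr x e * sinh (val v)).
Proof.
set J0 := vals (fupd x e v0).
have bE s : boltzmann (vals (fupd x e v)) s =
    boltzmann J0 s * (cosh (val v) + chi e s * sinh (val v)).
  rewrite /boltzmann -expR_chi -expRD; congr expR.
  rewrite (bigD1 e)//= [in RHS](bigD1 e)//= /J0 !fupd_same val0 mul0r add0r addrC.
  by congr (_ + _); apply: eq_bigr => i ie; rewrite !fupd_other.
have -> : cosh (val v) + cavity_corr x e * sinh (val v) =
    Zfun (vals (fupd x e v)) / Zfun J0.
  have Z0 := Zfun_gt0 J0.
  apply: (mulIf (lt0r_neq0 Z0)); rewrite divfK ?gt_eqF//.
  rewrite /Zfun; under [RHS]eq_bigr do rewrite bE mulrDr mulrA.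
  rewrite big_split -!mulr_suml /= mulrDl [cosh _ * _]mulrC; congr (_ + _).
  rewrite /cavity_corr -/J0 /corr mulrAC; congr (_ * _).
  rewrite mulr_suml; apply: eq_bigr => s _.
  by rewrite /gibbs mulrAC divfK ?gt_eqF.
rewrite ln_div ?posrE ?Zfun_gt0// /logZ; lra.
Qed.

Variable neg : V -> V.
Hypothesis negK : involutive neg.
Hypothesis valN : forall v, val (neg v) = - val v.

Definition symmetric_weight (w : V -> R) :=
  forall v, val v != 0 -> w (neg v) = w v.

(** Averaging over the sign of a coupling kills the odd part of its effect. *)
Lemma symmetric_gain w x e : symmetric_weight w ->
  \sum_v w v * (logZ (fupd x e v) - logZ (fupd x e v0)) =
  \sum_v w v * bond_gain (val v) (cavity_corr x e).
Proof.
move=> ws; set m := cavity_corr x e.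
pose G y := ln (cosh y + m * sinh y).
have GE v : logZ (fupd x e v) - logZ (fupd x e v0) = G (val v).
  by rewrite logZ_fupd /G -/m; lra.
have G0 : G 0 = 0 by rewrite /G cosh0 sinh0 mulr0 addr0 ln1.
under eq_bigr do rewrite GE.
have sw : \sum_v w v * G (val v) = \sum_v w v * G (- val v).
  rewrite (reindex_inj (inv_inj negK)); apply: eq_bigr => v _.
  rewrite valN; have [->|vn0] := eqVneq (val v) 0; first by rewrite oppr0 G0 !mulr0.
  by rewrite ws.
have gE v : bond_gain (val v) m = (G (val v) + G (- val v)) / 2.
  by rewrite /bond_gain /G coshN sinhN mulrN.
under [RHS]eq_bigr do rewrite gE mulrA mulrDr.
by rewrite -mulr_suml big_split /= -sw; lra.
Qed.

Lemma symmetric_gain_ge0 w x e : symmetric_weight w -> (forall v, 0 <= w v) ->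
  0 <= \sum_v w v * (logZ (fupd x e v) - logZ (fupd x e v0)).
Proof.
move=> ws w0; rewrite symmetric_gain//; apply: sumr_ge0 => v _.
by rewrite mulr_ge0// bond_gain_ge0// corr_le1.
Qed.

Lemma symmetric_gain_le w x e : symmetric_weight w -> (forall v, 0 <= w v) ->
  \sum_v w v * (logZ (fupd x e v) - logZ (fupd x e v0)) <=
  \sum_v w v * ln (cosh (val v)).
Proof.
move=> ws w0; rewrite symmetric_gain//; apply: ler_sum => v _.
by rewrite ler_wpM2l// bond_gain_le// corr_le1.
Qed.

End SpinSystem.

(** * Diluted laws and interpolation between them *)

Section Dilution.
Variables (R : realType) (V : finType) (ell : V -> R) (v0 : V).

(** Dilution as in a sparse random graph: ell stands for the restriction of a
    Levy measure, common to all sizes, and only the rate a depends on the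
    size. *)
Definition diluted (a : R) (v : V) : R :=
  a * ell v + (1 - a * \sum_u ell u) * (v == v0)%:R.

Hypothesis ell0 : forall v, 0 <= ell v.

Lemma diluted_law a : 0 <= a -> a * \sum_u ell u <= 1 -> is_law (diluted a).
Proof.
move=> a0 a1; split=> [v|].
  by rewrite addr_ge0 ?mulr_ge0// subr_ge0.
have d1 : \sum_v (v == v0)%:R = 1 :> R.
  by rewrite (bigD1 v0)//= eqxx big1 ?addr0// => v /negbTE ->.
by rewrite big_split /= -!mulr_sumr d1; ring.
Qed.

Lemma sum_delta (g : V -> R) : \sum_v (v == v0)%:R * g v = g v0.
Proof.
rewrite (bigD1 v0)//= eqxx mul1r big1 ?addr0// => v /negbTE ->.
by rewrite mul0r.
Qed.

Lemma diluted_avg a (g : V -> R) :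
  \sum_v diluted a v * g v = g v0 + a * \sum_v ell v * (g v - g v0).
Proof.
under eq_bigr do rewrite /diluted mulrDl -mulrA -[_ * _ * g _]mulrA.
rewrite big_split /= -!mulr_sumr sum_delta.
have -> : \sum_v ell v * (g v - g v0) =
    \sum_v ell v * g v - (\sum_v ell v) * g v0.
  by rewrite mulr_suml -sumrB; apply: eq_bigr => v _; rewrite mulrBr.
ring.
Qed.

End Dilution.

Section Interpolation.
Variables (R : realType) (n : nat) (S V : finType) (sig : 'I_n -> S -> R).
Variables (val : V -> R) (v0 : V) (s0 : S) (neg : V -> V) (ell : V -> R).
Hypothesis sig2 : forall i s, sig i s ^+ 2 = 1.
Hypothesis val0 : val v0 = 0.
Hypothesis negK : involutive neg.
Hypothesis valN : forall v, val (neg v) = - val v.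
Hypothesis ell0 : forall v, 0 <= ell v.
Hypothesis ell_sym : symmetric_weight val neg ell.

Local Notation edge := ('I_n * 'I_n)%type.

Definition pair_chi (e : edge) (s : S) : R := sig e.1 s * sig e.2 s.
Definition upper (e : edge) : bool := (e.1 < e.2)%N.
Definition ell_log_cosh : R := \sum_v ell v * ln (cosh (val v)).

Lemma pair_chi2 e s : pair_chi e s ^+ 2 = 1.
Proof. by rewrite exprMn !sig2 mulr1. Qed.

Lemma sum_upper (K : 'I_n -> 'I_n -> R) :
  (forall i j, K i j = K j i) -> (forall i, K i i = 0) ->
  \sum_i \sum_j K i j = 2 * \sum_(e | upper e) K e.1 e.2.
Proof.
move=> Ks Kd; rewrite pair_bigA /= (bigID upper)/= [X in _ + X](_ : _ =
  \sum_(e | upper e) K e.1 e.2); first by rewrite mulr_natl mulr2n.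
rewrite (bigID (fun e : edge => e.1 == e.2))/= big1 ?add0r; last first.
  by move=> [i j] /= /andP[_ /eqP->].
have swK : involutive (fun e : edge => (e.2, e.1)) by case.
rewrite (reindex_inj (inv_inj swK))/=.
apply: eq_big => [[i j]|[i j] _] /=; last exact: Ks.
by rewrite /upper /= -leqNgt [in RHS]ltn_neqAle andbC eq_sym.
Qed.

(** The quadratic form of the interpolation weights is minus a square, and
    the bond gain is ln cosh minus a positive semidefinite kernel in the
    correlations; the ln cosh part drops out because u sums to zero and the
    diagonal because a site is perfectly correlated with itself. *)
Lemma interpolation_sign (J : edge -> R) (u : 'I_n -> R) : \sum_i u i = 0 ->
  \sum_(e | upper e) u e.1 * u e.2 *
     \sum_v ell v * bond_gain (val v) (corr pair_chi J e) <= 0.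
Proof.
move=> u0.
pose p := gibbs pair_chi J.
have p0 s : 0 <= p s by exact: gibbs_ge0.
have ov i j : overlap p sig i j = corr pair_chi J (i, j) by [].
have ov1 i j : `|overlap p sig i j| <= 1 by rewrite ov; exact: (corr_le1 s0 pair_chi2).
have ovd i : overlap p sig i i = 1.
  rewrite -[RHS](gibbs_sum pair_chi s0 J); apply: eq_bigr => s _.
  by rewrite -expr2 sig2 mulr1.
have ovs i j : overlap p sig i j = overlap p sig j i.
  by apply: eq_bigr => s _; rewrite [sig i s * _]mulrC.
have key v : \sum_(e | upper e) u e.1 * u e.2 *
    bond_gain (val v) (corr pair_chi J e) <= 0.
  pose K i j := u i * u j * bond_gain (val v) (overlap p sig i j).
  have Ks i j : K i j = K j i by rewrite /K ovs [u i * _]mulrC.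
  have Kd i : K i i = 0 by rewrite /K ovd bond_gain1 mulr0.
  have := sum_upper Ks Kd; rewrite /K.
  have -> : \sum_i \sum_j u i * u j * bond_gain (val v) (overlap p sig i j) =
      - (\sum_i \sum_j u i * u j *
          - ln (1 - (sinh (val v) / cosh (val v)) ^+ 2 * overlap p sig i j ^+ 2)) / 2.
    have z : \sum_i \sum_j u i * u j * ln (cosh (val v)) = 0.
      under eq_bigr do rewrite -mulr_suml -mulr_sumr.
      by rewrite -!mulr_suml u0 !mul0r.
    transitivity (\sum_i \sum_j (u i * u j * ln (cosh (val v)) - u i * u j *
      - ln (1 - (sinh (val v) / cosh (val v)) ^+ 2 * overlap p sig i j ^+ 2) / 2)).
      apply: eq_bigr => i _; apply: eq_bigr => j _.
      by rewrite bond_gainE//; lra.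
    under eq_bigr do rewrite sumrB -[X in _ - X]mulr_suml.
    by rewrite sumrB z -mulr_suml sub0r mulNr.
  have := log_kernel_psd p0 u (tanh2_bounds (val v)) ov1.
  set A := (\sum_i \sum_j _); set B := (\sum_(e | _) _) => A0 AB.
  lra.
under eq_bigr do rewrite mulr_sumr.
rewrite exchange_big /=; apply: sumr_le0 => v _.
rewrite (eq_bigr (fun e => ell v * (u e.1 * u e.2 *
   bond_gain (val v) (corr pair_chi J e)))); last by move=> e _; ring.
by rewrite -mulr_sumr mulr_ge0_le0.
Qed.

(** Along the interpolation each bond e contributes its rate of change times
    the gain of an extra coupling.  The gain is first replaced by the one
    measured with the coupling of e kept in place, so that a single Gibbs
    measure serves all bonds; the replacement costs the probability that e is
    occupied. *)
Lemma interpolation_increment (a : edge -> R) (k amax : R) (u : 'I_n -> R) :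
  let b e := if upper e then - k * u e.1 * u e.2 else 0 in
  0 <= k -> \sum_i u i = 0 ->
  (forall e t, 0 <= t <= 1 -> 0 <= a e + t * b e <= amax) ->
  amax * \sum_v ell v <= 1 ->
  - (\sum_e `|b e| * (amax * (\sum_v ell v) * ell_log_cosh)) <=
  pmean (fun e => diluted ell v0 (a e + b e)) (logZ pair_chi val) -
  pmean (fun e => diluted ell v0 (a e)) (logZ pair_chi val).
Proof.
move=> b k0 u0 ha hmax.
set L := \sum_v ell v; set kap := ell_log_cosh.
have L0 : 0 <= L by exact: sumr_ge0.
have kap0 : 0 <= kap.
  by apply: sumr_ge0 => v _; rewrite mulr_ge0// ln_cosh_ge0.
pose al e v := diluted ell v0 (a e) v.
pose be e (v : V) := b e * (ell v - L * (v == v0)%:R).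
have -> : pmean (fun e => diluted ell v0 (a e + b e)) (logZ pair_chi val) =
    pmean (fun e v => al e v + be e v) (logZ pair_chi val).
  by apply: eq_pmean_law => e v; rewrite /al /be /diluted -/L; ring.
apply: pmean_segment => t t01.
pose rho e := diluted ell v0 (a e + t * b e).
have rhoE : (fun e v => al e v + t * be e v) =2 rho.
  by move=> e v; rewrite /rho /al /be /diluted -/L; ring.
have amax0 e : a e + t * b e <= amax by have /andP[] := ha e t t01.
have rlaw e : is_law (rho e).
  have /andP[h1 h2] := ha e t t01; apply: diluted_law => //.
  by apply: le_trans hmax; rewrite ler_wpM2r.
have r1 e : \sum_v rho e v = 1 by case: (rlaw e).
pose gain (m : R) := \sum_v ell v * bond_gain (val v) m.
have gain0 (m : R) : `|m| <= 1 -> 0 <= gain m.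
  by move=> m1; apply: sumr_ge0 => v _; rewrite mulr_ge0// bond_gain_ge0.
have gain1 (m : R) : `|m| <= 1 -> gain m <= kap.
  by move=> m1; apply: ler_sum => v _; rewrite ler_wpM2l// bond_gain_le.
have dist_le (y z : R) : 0 <= y -> y <= kap -> 0 <= z -> z <= kap -> `|y - z| <= kap.
  by move=> *; rewrite ler_norml; apply/andP; split; lra.
pose J (x : {ffun edge -> V}) := fun e => val (x e).
pose Hc e x := gain (cavity_corr pair_chi val v0 x e).
pose H e x := gain (corr pair_chi (J x) e).
have cle := corr_le1 s0 pair_chi2.
have dE e : pmean (lupd (fun e v => al e v + t * be e v) e (be e)) (logZ pair_chi val)
    = b e * pmean rho (Hc e).
  rewrite (@eq_pmean_law _ _ _ _ (lupd rho e (be e))); last first.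
    by move=> i v; rewrite /lupd; case: ifP => // _; exact: rhoE.
  rewrite pmean_resample// -pmeanZ; apply: eq_pmean => x.
  rewrite /Hc /gain -(symmetric_gain s0 pair_chi2 val0 negK valN)//.
  under eq_bigr do rewrite /be -mulrA mulrBl -mulrA.
  rewrite -mulr_sumr sumrB -mulr_sumr sum_delta; congr (_ * _).
  by rewrite mulr_suml -sumrB; apply: eq_bigr => v _; rewrite mulrBr.
have HcH e : `|pmean rho (Hc e) - pmean rho (H e)| <= amax * L * kap.
  have /andP[a0 _] := ha e t t01.
  pose G x v := Hc e (fupd x e v) - H e (fupd x e v).
  have G0 x : G x v0 = 0 by rewrite /G /Hc /H /cavity_corr fupd_fupd subrr.
  have Gb x v : `|G x v| <= kap.
    by apply: dist_le; rewrite ?gain0 ?gain1 ?cle.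
  have -> : pmean rho (Hc e) - pmean rho (H e) =
      pmean rho (fun x => \sum_v rho e v * G x v).
    by rewrite -pmeanB (pmean_average (e := e)).
  clearbody G.
  have bd x : `|\sum_v rho e v * G x v| <= amax * L * kap.
    rewrite diluted_avg G0 add0r normrM (ger0_norm a0) -mulrA.
    apply: ler_pM => //; rewrite /L mulr_suml.
    apply: le_trans (ler_norm_sum _ _ _) _; apply: ler_sum => v _.
    by rewrite subr0 normrM (ger0_norm (ell0 v)) ler_wpM2l.
  rewrite ler_norml -(pmean_cst (amax * L * kap) rlaw).
  rewrite -[X in X <= _]mulN1r -pmeanZ.
  apply/andP; split; apply: le_pmean => // x; have := bd x;
    rewrite ler_norml => /andP[]; lra.
have main : 0 <= \sum_e b e * pmean rho (H e).
  under eq_bigr do rewrite -pmeanZ.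
  rewrite -pmean_sum; apply: pmean_ge0 => // x.
  have := interpolation_sign (J x) u0.
  rewrite -oppr_ge0 => h; have := mulr_ge0 k0 h; rewrite mulrN mulr_sumr -sumrN.
  rewrite big_mkcond /= => /le_trans; apply; apply: ler_sum => e _.
  rewrite /b; case: ifP => _; last by rewrite mul0r.
  by rewrite /H /gain !mulNr !mulrA.
rewrite [leRHS](eq_bigr (fun e => b e * pmean rho (Hc e))); last by move=> e _; exact: dE.
rewrite -sumrN.
have : \sum_e (b e * pmean rho (H e) - `|b e| * (amax * L * kap)) <=
    \sum_e b e * pmean rho (Hc e).
  apply: ler_sum => e _; rewrite lerBlDr -lerBlDl -mulrBr.
  apply: le_trans (ler_norm _) _; rewrite normrM ler_wpM2l// distrC; exact: HcH.
apply: le_trans; rewrite big_split /= lerDr//.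
Qed.

End Interpolation.

(** * Finite-volume superadditivity for discretised couplings *)

Section Replacement.
Variables (R : realType) (S I V : finType) (chi : I -> S -> R) (val : V -> R).
Variables (v0 : V) (s0 : S) (neg : V -> V) (ell : V -> R).
Hypothesis chi2 : forall e s, chi e s ^+ 2 = 1.
Hypothesis val0 : val v0 = 0.
Hypothesis negK : involutive neg.
Hypothesis valN : forall v, val (neg v) = - val v.
Hypothesis ell0 : forall v, 0 <= ell v.
Hypothesis ell_sym : symmetric_weight val neg ell.
Variables (w : I -> V -> R) (a : I -> R).
Hypothesis w_law : forall e, is_law (w e).
Hypothesis w_sym : forall e, symmetric_weight val neg (w e).
Hypothesis a0 : forall e, 0 <= a e.
Hypothesis a_le : forall e v, a e * ell v <= w e v.

Let rest e v := w e v - a e * ell v.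

Let rest_sym e : symmetric_weight val neg (rest e).
Proof. by move=> v vn0; rewrite /rest w_sym// ell_sym. Qed.

Let rest0 e v : 0 <= rest e v.
Proof. by rewrite subr_ge0. Qed.

Let rest_avg e (g : V -> R) :
  \sum_v w e v * g v =
  \sum_v diluted ell v0 (a e) v * g v + \sum_v rest e v * (g v - g v0).
Proof.
rewrite diluted_avg -addrA mulr_sumr -big_split /=.
have -> : \sum_v w e v * g v = g v0 + \sum_v w e v * (g v - g v0).
  under [in RHS]eq_bigr do rewrite mulrBr.
  by rewrite sumrB -mulr_suml (w_law e).2; ring.
by congr (_ + _); apply: eq_bigr => v _; rewrite /rest; ring.
Qed.

Let dil_law e : is_law (diluted ell v0 (a e)).
Proof.
apply: diluted_law => //; rewrite -(w_law e).2 mulr_sumr.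
by apply: ler_sum => v _.
Qed.

(** Dropping part of a symmetric coupling law can only lower the mean
    log-partition, by Jensen over the sign, and lowers it by at most the mean
    of ln cosh over the part that is dropped. *)
Lemma diluted_le_pmean :
  pmean (fun e => diluted ell v0 (a e)) (logZ chi val) <= pmean w (logZ chi val).
Proof.
have <- : pmean w (logZ chi val) + \sum_(e : I) 0 = pmean w (logZ chi val).
  by rewrite big1 ?addr0.
apply: pmean_replace => // e x; rewrite addr0 rest_avg lerDl.
exact: (symmetric_gain_ge0 s0 chi2 val0 negK valN).
Qed.

Lemma pmean_le_diluted :
  pmean w (logZ chi val) <= pmean (fun e => diluted ell v0 (a e)) (logZ chi val) +
    \sum_e \sum_v (w e v - a e * ell v) * ln (cosh (val v)).
Proof.
apply: pmean_replace => // e x; rewrite rest_avg lerD2l.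
exact: (symmetric_gain_le s0 chi2 val0 negK valN).
Qed.

End Replacement.

Lemma sum_pairE (R : nmodType) (A B : finType) (F : A * B -> R) :
  \sum_e F e = \sum_i \sum_j F (i, j).
Proof. by rewrite pair_bigA /=; apply: eq_bigr => -[]. Qed.

Section IsingSplit.
Variables (R : realType) (V : finType) (val : V -> R) (v0 : V).
Hypothesis val0 : val v0 = 0.

Definition ising_sig (n : nat) (i : 'I_n) (s : {ffun 'I_n -> bool}) : R := spin R (s i).
Definition ising_chi (n : nat) := pair_chi (@ising_sig n).

Lemma ising_sig2 n (i : 'I_n) s : ising_sig i s ^+ 2 = 1.
Proof. by rewrite /ising_sig /spin -exprM mulnC exprM sqrrN !expr1n. Qed.

Definition left_edge M N (e : 'I_M * 'I_M) : 'I_(M + N) * 'I_(M + N) :=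
  (lshift N e.1, lshift N e.2).
Definition right_edge M N (e : 'I_N * 'I_N) : 'I_(M + N) * 'I_(M + N) :=
  (rshift M e.1, rshift M e.2).

Lemma left_edge_inj M N : injective (@left_edge M N).
Proof. by move=> [i j] [k l] [/= /ord_inj-> /ord_inj->]. Qed.

Lemma right_edge_inj M N : injective (@right_edge M N).
Proof.
by move=> [i j] [k l] [/= /addnI/ord_inj-> /addnI/ord_inj->].
Qed.

Definition join_spins M N (p : {ffun 'I_M -> bool} * {ffun 'I_N -> bool}) :
    {ffun 'I_(M + N) -> bool} :=
  [ffun i => match fintype.split i with inl j => p.1 j | inr j => p.2 j end].

Lemma join_spins_bij M N : bijective (@join_spins M N).
Proof.
exists (fun s : {ffun 'I_(M + N) -> bool} =>
  ([ffun i => s (lshift N i)], [ffun i => s (rshift M i)])).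
  move=> [s1 s2]; congr pair; apply/ffunP => i; rewrite !ffunE.
    by rewrite (unsplitK (inl i)).
  by rewrite (unsplitK (inr i)).
move=> s; apply/ffunP => i; rewrite !ffunE.
by case: splitP => j ij; rewrite ffunE; congr (s _); apply/val_inj.
Qed.

(** A configuration of the whole is a pair of configurations of the blocks, and
    the energy is additive once the couplings across vanish. *)
Lemma logZ_blocks M N (x : {ffun 'I_(M + N) * 'I_(M + N) -> V}) :
  (forall i j, x (lshift N i, rshift M j) = v0) ->
  (forall i j, x (rshift M i, lshift N j) = v0) ->
  logZ (@ising_chi (M + N)) val x =
  logZ (@ising_chi M) val [ffun e => x (left_edge N e)] +
  logZ (@ising_chi N) val [ffun e => x (right_edge M e)].
Proof.
move=> x1 x2; rewrite /logZ -lnM ?posrE; last 2 first.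
- exact: (Zfun_gt0 _ [ffun=> false]).
- exact: (Zfun_gt0 _ [ffun=> false]).
congr ln; rewrite /Zfun (reindex (@join_spins M N)); last exact/onW_bij/join_spins_bij.
rewrite mulr_suml sum_pairE.
apply: eq_bigr => s1 _; rewrite mulr_sumr; apply: eq_bigr => s2 _.
rewrite /boltzmann -expRD; congr expR.
have jl i : join_spins (s1, s2) (lshift N i) = s1 i.
  by rewrite ffunE (unsplitK (inl i)).
have jr i : join_spins (s1, s2) (rshift M i) = s2 i.
  by rewrite ffunE (unsplitK (inr i)).
rewrite !sum_pairE big_split_ord /=; congr (_ + _).
  apply: eq_bigr => i _; rewrite big_split_ord /= [X in _ + X]big1 ?addr0.
    by apply: eq_bigr => j _; rewrite ffunE /ising_chi /pair_chi /ising_sig /= !jl.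
  by move=> j _; rewrite x1 val0 mul0r.
apply: eq_bigr => i _; rewrite big_split_ord /= big1 ?add0r.
  by apply: eq_bigr => j _; rewrite ffunE /ising_chi /pair_chi /ising_sig /= !jr.
by move=> j _; rewrite x2 val0 mul0r.
Qed.

End IsingSplit.

Lemma eq_pmean_support (R : realType) (I V : finType) (rho : I -> V -> R)
    (f g : {ffun I -> V} -> R) :
  (forall x : {ffun I -> V}, (forall e, rho e (x e) != 0) -> f x = g x) ->
  pmean rho f = pmean rho g.
Proof.
move=> h; apply: eq_bigr => x _.
have [p0|pn0] := eqVneq (\prod_i rho i (x i)) 0; first by rewrite p0 !mul0r.
by rewrite h// => e; move/prodf_neq0: pn0; exact.
Qed.

Section FiniteSuperadditivity.
Variables (R : realType) (V : finType) (val : V -> R) (v0 : V).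
Variables (neg : V -> V) (ell : V -> R).
Hypothesis val0 : val v0 = 0.
Hypothesis negK : involutive neg.
Hypothesis valN : forall v, val (neg v) = - val v.

(** Couplings outside the upper triangle are frozen at the null value, so that
    all sums and products run over the full square and the passage to a block
    is a plain reindexing. *)
Definition edge_law n (w : V -> R) (e : 'I_n * 'I_n) (v : V) : R :=
  if upper e then w v else (v == v0)%:R.

Definition free_energy n (w : V -> R) : R :=
  pmean (edge_law (n := n) w) (logZ (@ising_chi R n) val).

Lemma delta_law : is_law (fun v => (v == v0)%:R : R).
Proof.
by split=> // ; rewrite (bigD1 v0)//= eqxx big1 ?addr0// => v /negbTE ->.
Qed.

Lemma edge_law_is_law n w : is_law w -> forall e, is_law (@edge_law n w e).
Proof.
by move=> hw e; rewrite /edge_law; case: (upper e) => //; exact: delta_law.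
Qed.

Lemma delta_sym : symmetric_weight val neg (fun v => (v == v0)%:R : R).
Proof.
move=> v vn0; have -> : (v == v0) = false.
  by apply: contraNF vn0 => /eqP->; rewrite val0.
have -> // : (neg v == v0) = false.
apply: contraNF vn0 => /eqP h.
by rewrite -oppr_eq0 -valN h val0.
Qed.

Lemma edge_law_sym n w : symmetric_weight val neg w ->
  forall e, symmetric_weight val neg (@edge_law n w e).
Proof.
by move=> hw e; rewrite /edge_law; case: (upper e) => //; exact: delta_sym.
Qed.

Lemma sum_edges_le n (F : 'I_n * 'I_n -> R) (c : R) :
  (forall e, F e <= c) -> \sum_e F e <= n%:R ^+ 2 * c.
Proof.
move=> h; apply: (@le_trans _ _ (\sum_(e : 'I_n * 'I_n) c)); first exact: ler_sum.
by rewrite sumr_const card_prod card_ord -[leLHS]mulr_natl natrM expr2.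
Qed.

Lemma sum_edge_log_cosh n (w : V -> R) (e : 'I_n * 'I_n) :
  (forall v, 0 <= w v) ->
  \sum_v edge_law w e v * ln (cosh (val v)) <= \sum_v w v * ln (cosh (val v)).
Proof.
move=> w0; rewrite /edge_law; case: (upper e) => //.
rewrite (sum_delta v0 (fun v => ln (cosh (val v)))) val0 cosh0 ln1.
by apply: sumr_ge0 => v _; rewrite mulr_ge0// ln_cosh_ge0.
Qed.

Lemma free_energy_le n (w : V -> R) : is_law w -> symmetric_weight val neg w ->
  free_energy n w <= n%:R * ln 2 + n%:R ^+ 2 * \sum_v w v * ln (cosh (val v)).
Proof.
move=> wl ws.
have z0 (v : V) : 0 <= (0 : R) by [].
have z1 (e : 'I_n * 'I_n) : 0 <= (0 : R) by [].
have := @pmean_le_diluted R _ _ V (@ising_chi R n) val v0 [ffun=> false] neg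
  (fun=> 0) (pair_chi2 (@ising_sig2 R n)) val0 negK valN z0 (fun _ _ => erefl)
  (edge_law w) (fun=> 0) (edge_law_is_law wl) (edge_law_sym ws) z1.
have h e v : 0 * 0 <= @edge_law n w e v by rewrite mulr0; exact: (edge_law_is_law wl e).1.
move=> /(_ h) /le_trans; apply; apply: lerD.
  rewrite (@eq_pmean_support _ _ _ _ _ (fun=> n%:R * ln 2)).
    by rewrite pmean_cst// => e; apply: diluted_law; rewrite // big1 ?mul0r.
  move=> x hx; rewrite /logZ /Zfun; under eq_bigr => s _.
    rewrite /boltzmann big1 ?expR0; first over.
    move=> e _; have := hx e; rewrite /diluted mulr0 add0r mul0r subr0 mul1r.
    by case: (x e =P v0) => [->|]; rewrite ?eqxx// val0 mul0r.
  rewrite sumr_const card_ffun card_bool card_ord natrX lnXn//.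
  by rewrite mulr_natl.
apply: sum_edges_le => e; under eq_bigr do rewrite mulr0 subr0.
by apply: sum_edge_log_cosh; case: wl.
Qed.

Hypothesis ell0 : forall v, 0 <= ell v.
Hypothesis ell_sym : symmetric_weight val neg ell.

Definition small_part n (w : V -> R) : R :=
  \sum_v (w v - ell v / n%:R) * ln (cosh (val v)).

Definition upper_rate n (e : 'I_n * 'I_n) : R := if upper e then n%:R^-1 else 0.

Lemma diluted0E v : diluted ell v0 0 v = (v == v0)%:R.
Proof. by rewrite /diluted !mul0r add0r subr0 mul1r. Qed.

Lemma rate_le n w : is_law w -> (forall v, ell v / n%:R <= w v) ->
  forall (e : 'I_n * 'I_n) v, upper_rate e * ell v <= edge_law w e v.
Proof.
move=> wl h e v; rewrite /upper_rate /edge_law; case: (upper e).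
  by rewrite mulrC.
by rewrite mul0r.
Qed.

Definition diluted_energy n : R :=
  pmean (fun e : 'I_n * 'I_n => diluted ell v0 (upper_rate e)) (logZ (@ising_chi R n) val).

Lemma upper_rate_ge0 n (e : 'I_n * 'I_n) : 0 <= upper_rate e.
Proof. by rewrite /upper_rate; case: (upper e). Qed.

Lemma diluted_energy_le n w : is_law w -> symmetric_weight val neg w ->
  (forall v, ell v / n%:R <= w v) -> diluted_energy n <= free_energy n w.
Proof.
move=> wl ws h; apply: (@diluted_le_pmean _ _ _ _ _ _ _ [ffun=> false] neg) => //.
- exact/pair_chi2/ising_sig2.
- exact: edge_law_is_law.
- exact: edge_law_sym.
- exact: upper_rate_ge0.
- exact: rate_le.
Qed.

Lemma free_energy_le_diluted n w : is_law w -> symmetric_weight val neg w ->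
  (forall v, ell v / n%:R <= w v) ->
  free_energy n w <= diluted_energy n + n%:R ^+ 2 * small_part n w.
Proof.
move=> wl ws h.
have := @pmean_le_diluted R _ _ V (@ising_chi R n) val v0 [ffun=> false] neg
  ell (pair_chi2 (@ising_sig2 R n)) val0 negK valN ell0 ell_sym
  (edge_law w) (@upper_rate n) (edge_law_is_law wl) (edge_law_sym ws)
  (@upper_rate_ge0 n) (rate_le wl h).
move=> /le_trans; apply; rewrite lerD2l; apply: sum_edges_le => e.
rewrite /upper_rate /edge_law /small_part; case: (upper e).
  by apply: ler_sum => v _; rewrite [_ * ell v]mulrC.
under eq_bigr do rewrite mul0r subr0.
rewrite (sum_delta v0 (fun v => ln (cosh (val v)))) val0 cosh0 ln1.
by apply: sumr_ge0 => v _; rewrite mulr_ge0 ?ln_cosh_ge0// subr_ge0.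
Qed.

(** The decoupled endpoint of the interpolation. *)
Definition block_rate M N (e : 'I_(M + N) * 'I_(M + N)) : R :=
  if upper e then
    if (e.1 < M)%N && (e.2 < M)%N then M%:R^-1
    else if (M <= e.1)%N && (M <= e.2)%N then N%:R^-1 else 0
  else 0.

Lemma pmean_block_rate M N :
  (forall e : 'I_(M + N) * 'I_(M + N), \sum_v diluted ell v0 (block_rate e) v = 1) ->
  pmean (fun e => diluted ell v0 (@block_rate M N e)) (logZ (@ising_chi R (M + N)) val) =
  diluted_energy M + diluted_energy N.
Proof.
move=> h1.
rewrite (@eq_pmean_support _ _ _ _ _ (fun x =>
  logZ (@ising_chi R M) val [ffun e => x (left_edge N e)] +
  logZ (@ising_chi R N) val [ffun e => x (right_edge M e)])); last first.
  move=> x hx; apply: (logZ_blocks val0) => i j.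
    have := hx (lshift N i, rshift M j).
    rewrite /block_rate /= ltn_ord /= [in (M + j < M)%N]ltnNge leq_addr /=.
    rewrite leqNgt ltn_ord /= if_same diluted0E.
    by case: (x _ =P v0) => // _; rewrite eqxx.
  have := hx (rshift M i, lshift N j).
  rewrite /block_rate /= ltn_ord andbT [in (M + i < M)%N]ltnNge leq_addr /=.
  rewrite leqNgt ltn_ord /= if_same diluted0E.
  by case: (x _ =P v0) => // _; rewrite eqxx.
rewrite pmeanD; congr (_ + _).
  rewrite (pmean_marginal (logZ (@ising_chi R M) val) (@left_edge_inj M N) h1).
  apply: eq_pmean_law => e v; congr (diluted _ _ _ _).
  by rewrite /block_rate /upper_rate /upper /= !ltn_ord.
rewrite (pmean_marginal (logZ (@ising_chi R N) val) (@right_edge_inj M N) h1).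
apply: eq_pmean_law => e v; congr (diluted _ _ _ _).
rewrite /block_rate /upper_rate /upper /= ltn_add2l !leq_addr /=.
by rewrite [(M + _ < M)%N]ltnNge leq_addr.
Qed.

Theorem free_energy_superadditive M N (wn wM wN : V -> R) (amax : R) :
  (0 < M)%N -> (0 < N)%N ->
  is_law wn -> is_law wM -> is_law wN ->
  symmetric_weight val neg wn -> symmetric_weight val neg wM ->
  symmetric_weight val neg wN ->
  (forall v, ell v / (M + N)%:R <= wn v) ->
  (forall v, ell v / M%:R <= wM v) ->
  (forall v, ell v / N%:R <= wN v) ->
  M%:R^-1 <= amax -> N%:R^-1 <= amax -> amax * \sum_v ell v <= 1 ->
  free_energy M wM + free_energy N wN <=
  free_energy (M + N) wn + M%:R ^+ 2 * small_part M wM + N%:R ^+ 2 * small_part N wN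
    + (M + N)%:R ^+ 2 * (amax ^+ 2 * (\sum_v ell v) * ell_log_cosh val ell).
Proof.
move=> M0 N0 ln_ lM lN sn sM sN en eM eN aM aN aL.
have hn := diluted_energy_le ln_ sn en.
have hM := free_energy_le_diluted lM sM eM.
have hN := free_energy_le_diluted lN sN eN.
have rM : 0 < M%:R :> R by rewrite ltr0n.
have rN : 0 < N%:R :> R by rewrite ltr0n.
have rn : 0 < (M + N)%:R :> R by rewrite ltr0n addn_gt0 M0.
have iM : 0 < (M%:R : R)^-1 by rewrite invr_gt0.
have iN : 0 < (N%:R : R)^-1 by rewrite invr_gt0.
have inn : 0 < ((M + N)%:R : R)^-1 by rewrite invr_gt0.
have an : ((M + N)%:R : R)^-1 <= amax.
  by apply: le_trans aM; rewrite lef_pV2 ?posrE// ler_nat leq_addr.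
pose u (i : 'I_(M + N)) : R := if (i < M)%N then M%:R^-1 else - N%:R^-1.
pose k : R := M%:R * N%:R / (M + N)%:R.
have k0 : 0 <= k by rewrite divr_ge0// ?mulr_ge0.
have u0 : \sum_i u i = 0.
  rewrite big_split_ord /= (eq_bigr (fun=> M%:R^-1)); last first.
    by move=> i _; rewrite /u /= ltn_ord.
  rewrite [X in _ + X](eq_bigr (fun=> - N%:R^-1)); last first.
    by move=> i _; rewrite /u /= ltnNge leq_addr.
  rewrite !sumr_const !card_ord -[X in X + _]mulr_natr -[X in _ + X]mulr_natr.
  by rewrite mulNr !mulVf ?subrr// gt_eqF.
pose b (e : 'I_(M + N) * 'I_(M + N)) := if upper e then - k * u e.1 * u e.2 else 0.
have bE e : block_rate e + b e = upper_rate e.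
  rewrite /block_rate /b /upper_rate; case: ifP => // _; last by rewrite addr0.
  rewrite /u /k natrD.
  have e1 : M%:R + N%:R != 0 :> R by rewrite -natrD gt_eqF.
  have e2 : M%:R != 0 :> R by rewrite gt_eqF.
  have e3 : N%:R != 0 :> R by rewrite gt_eqF.
  rewrite ![(M <= _)%N]leqNgt.
  by case: (e.1 < M)%N; case: (e.2 < M)%N => /=; field; rewrite ?e1 ?e2 ?e3.
have br e : 0 <= @block_rate M N e <= amax.
  rewrite /block_rate; case: ifP => _; last by rewrite lexx (le_trans (ltW iM)).
  case: ifP => _; first by rewrite (ltW iM) aM.
  by case: ifP => _; [rewrite (ltW iN) aN|rewrite lexx (le_trans (ltW iM))].
have ur e : 0 <= @upper_rate (M + N) e <= amax.
  rewrite /upper_rate; case: ifP => _; first by rewrite (ltW inn) an.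
  by rewrite lexx (le_trans (ltW iM)).
have ab e (t : R) : 0 <= t <= 1 -> 0 <= block_rate e + t * b e <= amax.
  move=> /andP[t0 t1].
  have -> : block_rate e + t * b e = (1 - t) * block_rate e + t * upper_rate e.
    by rewrite -bE; ring.
  have /andP[p1 p2] := br e; have /andP[p3 p4] := ur e.
  have t1' : 0 <= 1 - t by lra.
  rewrite addr_ge0 ?mulr_ge0//=.
  have -> : amax = (1 - t) * amax + t * amax by ring.
  by apply: lerD; apply: ler_wpM2l.
have L0 : 0 <= \sum_v ell v by apply: sumr_ge0.
have := interpolation_increment [ffun=> false] (@ising_sig2 R (M + N)) val0 negK valN
  ell0 ell_sym k0 u0 ab aL.
rewrite (@eq_pmean_law _ _ _ _ (fun e => diluted ell v0 (upper_rate e))); last first.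
  by move=> e v; rewrite -bE.
rewrite pmean_block_rate; last first.
  move=> e; have /andP[p1 p2] := br e.
  by apply: (diluted_law v0 ell0 p1 _).2; apply: le_trans aL; rewrite ler_wpM2r.
rewrite -/(diluted_energy (M + N)) => H.
have kap0 : 0 <= ell_log_cosh val ell.
  by apply: sumr_ge0 => v _; rewrite mulr_ge0// ln_cosh_ge0.
have E : \sum_e `|b e| * (amax * (\sum_v ell v) * ell_log_cosh val ell) <=
    (M + N)%:R ^+ 2 * (amax ^+ 2 * (\sum_v ell v) * ell_log_cosh val ell).
  apply: sum_edges_le => e.
  have -> : amax ^+ 2 * (\sum_v ell v) * ell_log_cosh val ell =
    amax * (amax * (\sum_v ell v) * ell_log_cosh val ell) by ring.
  rewrite ler_wpM2r// ?mulr_ge0// ?(le_trans (ltW iM))//.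
  have /andP[p1 p2] := br e; have /andP[p3 p4] := ur e.
  have -> : b e = upper_rate e - block_rate e by rewrite -bE; ring.
  by rewrite ler_norml; apply/andP; split; lra.
move: hn hM hN H E; rewrite /b; lra.
Qed.

End FiniteSuperadditivity.

(** * Moments from power-law tails *)

Section TailMoments.
Variables (R : realType) (V : finType) (w g : V -> R) (A alpha : R).
Hypothesis w0 : forall v, 0 <= w v.
Hypothesis g0 : forall v, 0 <= g v.
Hypothesis A0 : 0 <= A.
Hypothesis alpha0 : 0 < alpha.
Hypothesis tail : forall a, 0 < a -> \sum_(v | a <= g v) w v <= A * a `^ (- alpha).

Lemma exists_pow2 (B b : R) : 0 < b -> exists K, B < 2 ^+ K * b.
Proof.
move=> b0; exists (Num.bound (B / b)).
rewrite -ltr_pdivrMr//; apply: le_lt_trans (ler_norm _) _.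
apply: lt_trans (archi_boundP (normr_ge0 _)) _.
have -> : Num.bound `|B / b| = Num.bound (B / b) by rewrite /Num.bound normr_id.
by rewrite -natrX ltr_nat ltn_expl.
Qed.

Lemma powR_2lt1 (r : R) : r < 0 -> 0 < 2 `^ r < 1.
Proof.
move=> r0; rewrite powR_gt0//= -[ltRHS](powRr0 (2 : R)) /powR pnatr_eq0 /=.
by rewrite ltr_expR mul0r nmulr_rlt0// ln_gt0// ltr1n.
Qed.

(** Dyadic summation: the shell [b, 2b] costs at most the tail at b, and
    the remaining contributions form a geometric series. *)
Lemma large_moment (q b : R) : 0 <= q < alpha -> 0 < b ->
  \sum_(v | b <= g v) w v * g v `^ q <=
  A * (2 `^ q / (1 - 2 `^ (q - alpha))) * b `^ (q - alpha).
Proof.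
move=> /andP[q0 qa] b0.
have /andP[r0 r1] : 0 < 2 `^ (q - alpha) < 1 by apply: powR_2lt1; lra.
set r := 2 `^ (q - alpha) in r0 r1 *.
pose C := 2 `^ q / (1 - r).
have C0 : 0 <= C by apply: divr_ge0; [exact: powR_ge0|lra].
have Crec : 2 `^ q + C * r = C.
  by rewrite /C; field; rewrite subr_eq0 eq_sym lt_eqF.
have [B hB] : exists B, forall v, g v <= B.
  exists (\sum_v g v) => v; rewrite (bigD1 v)//= lerDl; exact: sumr_ge0.
have [K hK] := exists_pow2 B b0.
have {hK hB} : forall v, g v < 2 ^+ K * b by move=> v; exact: le_lt_trans (hB v) hK.
rewrite -/C; elim: K b b0 => [|K IH] b b0 hg.
  rewrite big_pred0; first by apply: mulr_ge0; [exact: mulr_ge0|exact: powR_ge0].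
  move=> v.
  by have := hg v; rewrite mul1r ltNge => /negbTE.
have b20 : 0 < 2 * b by lra.
have hg2 v : g v < 2 ^+ K * (2 * b) by rewrite mulrA -exprSr.
have {}IH := IH _ b20 hg2.
rewrite (bigID (fun v => 2 * b <= g v))/=.
have -> : A * C * b `^ (q - alpha) =
    A * C * (2 * b) `^ (q - alpha) + A * 2 `^ q * b `^ (q - alpha).
  by rewrite powRM ?ler0n ?(ltW b0)// -/r -{1}Crec; ring.
apply: lerD.
  apply: le_trans IH; rewrite le_eqVlt; apply/orP; left; apply/eqP.
  apply: eq_bigl => v; case: leP => //= ?; case: leP => //= ?;
    by rewrite ?andbT ?andbF //; lra.
apply: (@le_trans _ _ (\sum_(v | b <= g v) w v * (2 * b) `^ q)).
  rewrite [leRHS](bigID (fun v => 2 * b <= g v))/= ler_wpDl//.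
    by apply: sumr_ge0 => v _; rewrite mulr_ge0 ?powR_ge0.
  apply: ler_sum => v /andP[_]; rewrite -ltNge => gb.
  by rewrite ler_wpM2l// ge0_ler_powR ?nnegrE// ?ltW.
rewrite -mulr_suml powRM ?(ltW b0)//.
apply: le_trans (ler_wpM2r _ (tail b0)) _; first by rewrite mulr_ge0 ?powR_ge0.
rewrite powRD; last by rewrite (gt_eqF b0) implybT.
by rewrite le_eqVlt; apply/orP; left; apply/eqP; ring.
Qed.

(** The same recursion towards zero, over the shells [b/2, b]; it stops because
    the positive values of g are bounded away from 0. *)
Lemma small_moment (q b : R) : alpha < q -> 0 < b ->
  \sum_(v | g v < b) w v * g v `^ q <=
  A * (2 `^ alpha / (1 - 2 `^ (alpha - q))) * b `^ (q - alpha).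
Proof.
move=> qa b0.
have /andP[r0 r1] : 0 < 2 `^ (alpha - q) < 1 by apply: powR_2lt1; lra.
set r := 2 `^ (alpha - q) in r0 r1 *.
pose C := 2 `^ alpha / (1 - r).
have C0 : 0 <= C by apply: divr_ge0; [exact: powR_ge0|lra].
have Crec : 2 `^ alpha + C * r = C.
  by rewrite /C; field; rewrite subr_eq0 eq_sym lt_eqF.
have h2 : (2^-1 : R) `^ (q - alpha) = r.
  by rewrite -powR_inv1// -powRrM /r; congr (_ `^ _); ring.
have [K hK] : exists K, forall v, g v = 0 \/ b <= 2 ^+ K * g v.
  have h v : exists K, g v = 0 \/ b <= 2 ^+ K * g v.
    have [->|gn0] := eqVneq (g v) 0; first by exists 0%N; left.
    have gp : 0 < g v by rewrite lt_def gn0 g0.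
    by have [K /ltW hK] := exists_pow2 b gp; exists K; right.
  have [k hk] := choice h.
  exists (\max_v k v)%N => v; have [->|hv] := hk v; [by left|right].
  apply: le_trans hv _; rewrite ler_wpM2r//.
  by apply: ler_weXn2l; [rewrite ler1n|exact: leq_bigmax].
rewrite -/C; elim: K b b0 hK => [|K IH] b b0 hg.
  rewrite big1; first by apply: mulr_ge0; [exact: mulr_ge0|exact: powR_ge0].
  move=> v gb.
  have [->|] := hg v; first by rewrite powR0 ?mulr0// gt_eqF// (lt_trans alpha0).
  by rewrite mul1r leNgt gb.
have b20 : 0 < b / 2 by lra.
have hg2 v : g v = 0 \/ b / 2 <= 2 ^+ K * g v.
  by have [->|h] := hg v; [left|right; move: h; rewrite exprS; lra].
have {}IH := IH _ b20 hg2.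
rewrite (bigID (fun v => g v < b / 2))/=.
have -> : A * C * b `^ (q - alpha) =
    A * C * (b / 2) `^ (q - alpha) + A * 2 `^ alpha * b `^ (q - alpha).
  by rewrite powRM ?invr_ge0 ?(ltW b0)// h2 -{1}Crec; ring.
apply: lerD.
  apply: le_trans IH; rewrite le_eqVlt; apply/orP; left; apply/eqP.
  by apply: eq_bigl => v; case: (ltP (g v) (b / 2)); rewrite ?andbT ?andbF// => ?; lra.
apply: (@le_trans _ _ (\sum_(v | b / 2 <= g v) w v * b `^ q)).
  rewrite [leRHS](bigID (fun v => g v < b))/= ler_wpDr//.
    by apply: sumr_ge0 => v _; rewrite mulr_ge0 ?powR_ge0.
  rewrite [leRHS](eq_bigl (fun v => (g v < b) && ~~ (g v < b / 2))); last first.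
    by move=> v; rewrite -leNgt andbC.
  apply: ler_sum => v /andP[gb _].
  by rewrite ler_wpM2l// ge0_ler_powR ?nnegrE// ?ltW// (lt_trans alpha0).
rewrite -mulr_suml; apply: le_trans (ler_wpM2r _ (tail b20)) _; first exact: powR_ge0.
rewrite powRM ?invr_ge0 ?(ltW b0)// -[X in _ * (_ * X `^ _)]powR_inv1// -powRrM mulN1r opprK.
rewrite powRD; last by rewrite (gt_eqF b0) implybT.
by rewrite le_eqVlt; apply/orP; left; apply/eqP; ring.
Qed.

(** Below the scale b the power is at most b ^ q, above it [large_moment]
    applies; for a coupling of natural scale b both parts have the same
    order. *)
Lemma full_moment (q b : R) : 0 <= q < alpha -> 0 < b -> \sum_v w v <= 1 ->
  A <= 2 * b `^ alpha ->
  \sum_v w v * g v `^ q <= (1 + 2 * (2 `^ q / (1 - 2 `^ (q - alpha)))) * b `^ q.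
Proof.
move=> /andP[q0 qa] b0 w1 Ab.
rewrite (bigID (fun v => b <= g v))/= mulrDl mul1r addrC; apply: lerD.
  apply: (@le_trans _ _ (\sum_v w v * b `^ q)).
    rewrite [leRHS](bigID (fun v => b <= g v))/= ler_wpDl//.
      by apply: sumr_ge0 => v _; rewrite mulr_ge0 ?powR_ge0.
    apply: ler_sum => v; rewrite -ltNge => gb.
    by rewrite ler_wpM2l// ge0_ler_powR ?nnegrE// ltW.
  by rewrite -mulr_suml ler_piMl ?powR_ge0.
have hq : 0 <= q < alpha by rewrite q0.
apply: le_trans (large_moment hq b0) _.
have /andP[r0 r1] : 0 < 2 `^ (q - alpha) < 1 by apply: powR_2lt1; lra.
set C := 2 `^ q / _.
have C0 : 0 <= C by apply: divr_ge0; [exact: powR_ge0|lra].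
have -> : 2 * C * b `^ q = (2 * b `^ alpha) * C * b `^ (q - alpha).
  have -> : b `^ q = b `^ alpha * b `^ (q - alpha).
    by rewrite -powRD ?(gt_eqF b0) ?implybT//; congr (_ `^ _); ring.
  ring.
by rewrite ler_wpM2r ?powR_ge0// ler_wpM2r.
Qed.

End TailMoments.

(** * Concentration: a von Bahr--Esseen inequality *)

Section PowerInequality.
Variable R : realType.
Implicit Types p q x a b : R.

(** A combination, with weights q and 1 - q, of the tangent inequality of exp
    at q ln (1 + x), evaluated at ln (1 + x) and at 0. *)
Lemma powR_bernoulli q x : 0 <= q <= 1 -> -1 < x -> (1 + x) `^ q <= 1 + q * x.
Proof.
move=> /andP[q0 q1] x1; have x0 : 0 < 1 + x by lra.
set u := ln (1 + x).
have e1 : expR u = 1 + x by rewrite lnK// posrE.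
have -> : (1 + x) `^ q = expR (q * u) by rewrite /powR gt_eqF.
set y := expR (q * u).
have y0 : 0 < y by exact: expR_gt0.
have h1 : y * (1 + (1 - q) * u) <= 1 + x.
  have -> : 1 + x = y * expR ((1 - q) * u).
    by rewrite -expRD -e1; congr expR; ring.
  by rewrite ler_pM2l// expR_ge1Dx.
have h2 : y * (1 - q * u) <= 1.
  rewrite -[leRHS](expRxMexpNx_1 (q * u)) ler_pM2l//; exact: expR_ge1Dx.
have := ler_wpM2l q0 h1.
have q1' : 0 <= 1 - q by lra.
have := ler_wpM2l q1' h2.
lra.
Qed.

(** For |x| < 1 write |1 + x| ^ p as (1 + x) times a power with exponent
    p - 1 <= 1, to which [powR_bernoulli] applies, and use x ^ 2 <= |x| ^ p;
    elsewhere |x| ^ p dominates. *)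
Lemma powR_expand1 p x : 1 < p <= 2 -> `|1 + x| `^ p <= 1 + p * x + 4 * `|x| `^ p.
Proof.
move=> /andP[p1 p2]; have p0 : 0 <= p by lra.
have X0 : 0 <= `|x| `^ p by exact: powR_ge0.
have [x1|x1] := leP x (- 1).
  have ax : 1 <= `|x| by rewrite ler0_norm; lra.
  have h1 : `|1 + x| `^ p <= `|x| `^ p.
    rewrite ge0_ler_powR ?nnegrE//.
    by rewrite [`|x|]ler0_norm ?ler0_norm; lra.
  have h2 : `|x| <= `|x| `^ p by apply: le1r_powR; lra.
  move: h2 h1; rewrite [X in X <= _ -> _]ler0_norm; last lra.
  by nra.
have [x2|x2] := ltP x 1; last first.
  have h1 : `|1 + x| `^ p <= (2 * `|x|) `^ p.
    rewrite ge0_ler_powR ?nnegrE ?mulr_ge0//.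
    by rewrite !ger0_norm; lra.
  have h2 : (2 * `|x|) `^ p <= 4 * `|x| `^ p.
    rewrite powRM// ler_wpM2r//.
    have -> : 4 = 2 `^ 2%:R :> R by rewrite powR_mulrn// -natrX.
    by rewrite ler_powR// ler1n.
  have h3 : 0 <= p * x by apply: mulr_ge0; lra.
  by move: h1 h2; set y := (_ `^ _) => h1 h2; lra.
have x0 : 0 < 1 + x by lra.
have h : (1 + x) `^ (p - 1) <= 1 + (p - 1) * x by apply: powR_bernoulli; lra.
rewrite ger0_norm; last exact: ltW.
rewrite -(mulr_powRB1 (ltW x0)); last lra.
apply: le_trans (ler_wpM2l (ltW x0) h) _.
have hx : x ^+ 2 <= `|x| `^ p.
  have [->|xn0] := eqVneq x 0; first by rewrite expr0n powR_ge0.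
  rewrite -real_normK ?num_real// -powR_mulrn//; apply: ger_powR => //.
  by rewrite normr_gt0 xn0 ler_norml; lra.
have : (p - 1) * x ^+ 2 <= x ^+ 2 by rewrite ler_piMl ?sqr_ge0//; lra.
nra.
Qed.

(** The linear coefficient is left abstract: it only multiplies a centred
    variable. *)
Lemma powR_expand p : 1 < p <= 2 -> exists c : R -> R,
  forall a b, `|a + b| `^ p <= `|a| `^ p + c a * b + 4 * `|b| `^ p.
Proof.
move=> hp; have /andP[p1 p2] := hp.
exists (fun a => `|a| `^ p * p / a) => a b.
have [->|an0] := eqVneq a 0.
  rewrite invr0 mulr0 mul0r add0r addr0 normr0 powR0 ?add0r; last by rewrite gt_eqF//; lra.
  by have := powR_ge0 `|b| p; lra.
have -> : a + b = a * (1 + b / a) by field.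
rewrite normrM powRM//.
have -> : `|b| = `|a| * `|b / a| by rewrite -normrM; congr `|_|; field.
rewrite [X in _ <= _ + 4 * X]powRM//.
apply: le_trans (ler_wpM2l (powR_ge0 _ _) (powR_expand1 (b / a) hp)) _.
by rewrite le_eqVlt; apply/orP; left; apply/eqP; field.
Qed.

Lemma powRD_le p a b : 1 <= p <= 2 -> 0 <= a -> 0 <= b ->
  (a + b) `^ p <= 4 * (a `^ p + b `^ p).
Proof.
move=> /andP[p1 p2] a0 b0.
have h m : 0 <= m -> (2 * m) `^ p <= 4 * m `^ p.
  move=> m0; rewrite powRM// ler_wpM2r ?powR_ge0//.
  have -> : 4 = 2 `^ 2%:R :> R by rewrite powR_mulrn// -natrX.
  by rewrite ler_powR// ler1n.
have [ab|ba] := leP a b.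
  apply: (@le_trans _ _ ((2 * b) `^ p)); first by rewrite ge0_ler_powR ?nnegrE; lra.
  by apply: le_trans (h _ b0) _; have := powR_ge0 a p; lra.
apply: (@le_trans _ _ ((2 * a) `^ p)); first by rewrite ge0_ler_powR ?nnegrE; lra.
by apply: le_trans (h _ a0) _; have := powR_ge0 b p; lra.
Qed.

End PowerInequality.

Section Concentration.
Variables (R : realType) (I V : finType) (rho : I -> V -> R) (g : V -> R) (p : R).
Hypothesis rho_law : forall e, is_law (rho e).
Hypothesis g0 : forall v, 0 <= g v.
Hypothesis hp : 1 < p <= 2.
Implicit Types (f : {ffun I -> V} -> R).

Definition coord_lipschitz f :=
  forall x e v, `|f (fupd x e v) - f x| <= g v + g (x e).

Definition average e f (x : {ffun I -> V}) : R :=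
  \sum_v rho e v * f (fupd x e v).

Lemma average_lipschitz e f : coord_lipschitz f -> coord_lipschitz (average e f).
Proof.
move=> lf x i v; rewrite /average -sumrB.
have [->|ie] := eqVneq i e.
  rewrite big1 ?normr0 ?addr_ge0// => u _.
  by rewrite fupd_fupd subrr.
apply: le_trans (ler_norm_sum _ _ _) _.
rewrite -[leRHS]mul1r -(rho_law e).2 mulr_suml; apply: ler_sum => u _.
rewrite -mulrBr normrM (ger0_norm ((rho_law e).1 u)) ler_wpM2l ?(rho_law e).1//.
rewrite fupdC//; have := lf (fupd x e u) i v; rewrite fupd_other; exact.
Qed.

Definition depends_on f (D : pred I) :=
  forall x y : {ffun I -> V}, (forall i, D i -> x i = y i) -> f x = f y.

Lemma average_depends e f (D : pred I) : depends_on f D ->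
  depends_on (average e f) (fun i => D i && (i != e)).
Proof.
move=> df x y xy; apply: eq_bigr => v _; congr (_ * _); apply: df => i Di.
have [->|ie] := eqVneq i e; first by rewrite !fupd_same.
by rewrite !fupd_other// xy// Di.
Qed.

Variables (K1 Kp : I -> R).
Hypothesis hK1 : forall e, \sum_v rho e v * g v <= K1 e.
Hypothesis hKp : forall e, \sum_v rho e v * g v `^ p <= Kp e.

(** One coordinate at a time: conditionally on the others, the fluctuation of
    f around its average is centred, so the linear term of the expansion of the
    power disappears. *)
Lemma average_step e f c : coord_lipschitz f ->
  pmean rho (fun x => `|f x - c| `^ p) <=
  pmean rho (fun x => `|average e f x - c| `^ p) + 16 * (Kp e + K1 e `^ p).
Proof.
move=> lf; have [cc hc] := powR_expand hp; have /andP[p1 p2] := hp.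
have r0 v : 0 <= rho e v by case: (rho_law e).
have r1 : \sum_v rho e v = 1 by case: (rho_law e).
have K10 : 0 <= K1 e.
  by apply: le_trans (hK1 e); apply: sumr_ge0 => v _; rewrite mulr_ge0.
have fluct x : `|f x - average e f x| <= g (x e) + K1 e.
  have -> : f x - average e f x = \sum_v rho e v * (f x - f (fupd x e v)).
    under eq_bigr do rewrite mulrBr.
    by rewrite sumrB -mulr_suml r1 mul1r.
  apply: le_trans (ler_norm_sum _ _ _) _.
  apply: (@le_trans _ _ (\sum_v rho e v * (g v + g (x e)))).
    apply: ler_sum => v _; rewrite normrM (ger0_norm (r0 v)) ler_wpM2l//.
    by rewrite distrC.
  under eq_bigr do rewrite mulrDr.
  by rewrite big_split /= -mulr_suml r1 mul1r addrC lerD2l.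
have avg_fix x v : average e f (fupd x e v) = average e f x.
  by apply: eq_bigr => u _; rewrite fupd_fupd.
rewrite (pmean_average (e := e))//.
rewrite -(pmean_cst (16 * (Kp e + K1 e `^ p)) rho_law) -pmeanD.
apply: le_pmean => // x.
set a := average e f x - c.
pose b v := f (fupd x e v) - average e f x.
apply: (@le_trans _ _
  (\sum_v rho e v * (`|a| `^ p + cc a * b v + 16 * (g v `^ p + K1 e `^ p)))).
  apply: ler_sum => v _; rewrite ler_wpM2l//.
  have -> : f (fupd x e v) - c = a + b v by rewrite /a /b; ring.
  apply: le_trans (hc _ _) _; rewrite lerD2l.
  have -> : 16 = 4 * 4 :> R by ring.
  rewrite -mulrA ler_wpM2l//; have p1' : 1 <= p <= 2 by lra.
  apply: le_trans (powRD_le p1' (g0 v) K10).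
  rewrite ge0_ler_powR ?nnegrE ?addr_ge0//; first lra.
  by have := fluct (fupd x e v); rewrite avg_fix fupd_same.
rewrite (eq_bigr (fun v => rho e v * `|a| `^ p + cc a * (rho e v * b v) +
  16 * (rho e v * g v `^ p + rho e v * K1 e `^ p))); last by move=> v _; ring.
rewrite !big_split /= -!mulr_sumr big_split /= -!mulr_suml r1 !mul1r.
have -> : \sum_v rho e v * b v = 0.
  rewrite /b; under eq_bigr do rewrite mulrBr.
  by rewrite sumrB -mulr_suml r1 mul1r subrr.
by have := hKp e; lra.
Qed.

Lemma pmean_concentration f : coord_lipschitz f ->
  pmean rho (fun x => `|f x - pmean rho f| `^ p) <=
  \sum_e 16 * (Kp e + K1 e `^ p).
Proof.
move=> lf; have /andP[p1 p2] := hp.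
have s1 i : \sum_v rho i v = 1 by case: (rho_law i).
have [h [lh hf hh hc]] : exists h : {ffun I -> V} -> R,
    [/\ coord_lipschitz h, pmean rho h = pmean rho f,
    depends_on h (fun i => i \notin enum I) &
    forall c, pmean rho (fun x => `|f x - c| `^ p) <=
      pmean rho (fun x => `|h x - c| `^ p) + \sum_(e <- enum I) 16 * (Kp e + K1 e `^ p)].
  elim: (enum I) => [|e s [h [lh hf hh hc]]].
    exists f; split=> // [x y xy|c]; last by rewrite big_nil addr0.
    by congr f; apply/ffunP => i; exact: xy.
  exists (average e h); split; first exact: average_lipschitz.
  - by rewrite -hf [RHS](pmean_average (e := e)).
  - move=> x y xy; apply: (average_depends hh) => i /andP[i1 i2].
    by apply: xy; rewrite inE negb_or i2.
  - move=> c; apply: le_trans (hc c) _.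
    by rewrite big_cons addrA lerD2r average_step.
have hcst x : h x = pmean rho f.
  rewrite -hf -(pmean_cst (h x) rho_law); apply: eq_pmean => y.
  by apply: hh => i; rewrite mem_enum.
apply: le_trans (hc _) _; rewrite big_enum /= gerDr.
rewrite (eq_pmean rho (g := fun=> 0)) ?pmean_cst// => x.
by rewrite hcst subrr normr0 powR0// gt_eqF//; lra.
Qed.

End Concentration.

(** * Balanced superadditivity *)

Section Fekete.
Variable R : realType.

Lemma powR_le_neg (r x y : R) : r <= 0 -> 0 < x -> x <= y -> y `^ r <= x `^ r.
Proof.
move=> r0 x0 xy; have y0 : 0 < y by apply: lt_le_trans xy.
have q0 : 0 <= - r by rewrite oppr_ge0.
rewrite -[r]opprK; move: (- r) q0 => q q0.
by rewrite !powRN lef_pV2 ?posrE ?powR_gt0// ge0_ler_powR ?nnegrE// ltW.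
Qed.

Lemma powR_cvgy0 (r : R) : r < 0 -> (x `^ r) @[x --> +oo%R] --> (0 : R).
Proof.
move=> r0; apply/cvgrPdist_le => /= e e0.
have c0 : 0 < e `^ r^-1 by exact: powR_gt0.
exists (e `^ r^-1); split; first exact: num_real.
move=> x hx; rewrite sub0r normrN ger0_norm ?powR_ge0//.
have -> : e = (e `^ r^-1) `^ r by rewrite -powRrM mulVf ?lt_eqF// powRr1// ltW.
by apply: powR_le_neg => //; exact: ltW.
Qed.

Lemma powR_nat_cvg0 (r : R) : r < 0 -> (n%:R `^ r) @[n --> \oo] --> (0 : R).
Proof. by move=> r0; exact: (cvg_comp _ _ (@cvgr_idn R) (powR_cvgy0 r0)). Qed.

(** The limit is the supremum of a m / m.  For a fixed m, a large n is cut
    in two balanced pieces one of which is a multiple of m; iterating on the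
    other piece leaves a remainder of bounded size. *)
Lemma balanced_superadditive_cvg (a : nat -> R) (B : R) :
  (forall m n, (0 < m)%N -> (0 < n)%N -> (n <= 2 * m)%N -> (m <= 2 * n)%N ->
     a m + a n <= a (m + n)%N) ->
  (forall n, (0 < n)%N -> a n <= B * n%:R) ->
  exists l : R, (a n / n%:R) @[n --> \oo] --> l.
Proof.
move=> sa ub.
pose E := [set x | exists2 n, (0 < n)%N & x = a n / n%:R].
have supE : has_sup E.
  split; first by exists (a 1%N / 1%:R); exists 1%N.
  exists B => _ [n n0 ->]; rewrite ler_pdivrMr ?ltr0n//; exact: ub.
exists (sup E); apply/cvgrPdist_le => /= e e0.
have e20 : 0 < e / 2 by lra.
have [_ [m m0 ->] hm] := sup_adherent e20 supE.
set s := a m / m%:R in hm.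
pose c n := s * n%:R - a n.
have csub p q : (0 < p)%N -> (0 < q)%N -> (q <= 2 * p)%N -> (p <= 2 * q)%N ->
    c (p + q)%N <= c p + c q.
  by move=> p0 q0 h1 h2; have := sa p q p0 q0 h1 h2; rewrite /c natrD; lra.
have cm k : (0 < k)%N -> c (k * m)%N <= 0.
  elim/ltn_ind: k => k IH k0.
  have [k1|k1] := leqP k 1.
    have -> : k = 1%N by lia.
    by rewrite mul1n /c /s divfK ?subrr// pnatr_eq0 -lt0n.
  pose p := k./2; pose q := (k - k./2)%N.
  have pq : k = (p + q)%N by rewrite /p /q; lia.
  have hp : (0 < p < k)%N by rewrite /p; lia.
  have hq : (0 < q < k)%N by rewrite /q; lia.
  have qp : (q <= 2 * p)%N by rewrite /p /q; lia.
  have pq2 : (p <= 2 * q)%N by rewrite /p /q; lia.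
  have /andP[p0 pk] := hp; have /andP[q0 qk] := hq.
  rewrite pq mulnDl; apply: le_trans (csub _ _ _ _ _ _) _.
  - by rewrite muln_gt0 p0.
  - by rewrite muln_gt0 q0.
  - by rewrite mulnA leq_mul2r qp orbT.
  - by rewrite mulnA leq_mul2r pq2 orbT.
  by have := IH p pk p0; have := IH q qk q0; lra.
pose D := \sum_(j < 4 * m) `|c j|.
have cD n : (0 < n)%N -> c n <= D.
  elim/ltn_ind: n => n IH n0.
  have [nm|nm] := ltnP n (4 * m).
    rewrite /D (bigD1 (Ordinal nm))//=; apply: le_trans (ler_norm _) _.
    by rewrite lerDl; apply: sumr_ge0.
  pose k := (n %/ m)%N; pose p := k./2.
  have k4 : (4 <= k)%N by rewrite /k leq_divRL.
  have nk : (k * m <= n)%N by exact: leq_divM.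
  have nk1 : (n < (k + 1) * m)%N by rewrite addn1; exact: ltn_ceil.
  have p0 : (0 < p)%N by rewrite /p; lia.
  have kp : (2 * p <= k)%N by rewrite /p; lia.
  have kp3 : (k + 1 <= 3 * p)%N by rewrite /p; lia.
  have h1 : (2 * (p * m) <= n)%N by apply: leq_trans nk; rewrite mulnA leq_mul2r kp orbT.
  have h2 : (n < 3 * (p * m))%N by apply: (leq_trans nk1); rewrite mulnA leq_mul2r kp3 orbT.
  have pm0 : (0 < p * m)%N by rewrite muln_gt0 p0.
  have -> : n = (p * m + (n - p * m))%N by lia.
  apply: le_trans (csub _ _ _ _ _ _) _; try lia.
  have := cm p p0; have := IH (n - p * m)%N; have h3 : (n - p * m < n)%N by lia.
  have h4 : (0 < n - p * m)%N by lia.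
  by move=> /(_ h3 h4); lra.
have D0 : 0 <= D by apply: sumr_ge0.
exists (Num.bound (D / (e / 2))).+1 => // n /= hn.
have n0 : (0 < n)%N by lia.
have rn : 0 < n%:R :> R by rewrite ltr0n.
have h1 : a n / n%:R <= sup E.
  by apply: ub_le_sup; [exact: supE.2|exists n].
have h2 : s - D / n%:R <= a n / n%:R.
  rewrite ler_pdivlMr// mulrBl divfK ?gt_eqF//.
  by have := cD n n0; rewrite /c; lra.
have h3 : D / n%:R <= e / 2.
  rewrite ler_pdivrMr// mulrC -ler_pdivrMr//.
  apply: ltW; apply: lt_le_trans (archi_boundP _) _; first by rewrite divr_ge0// ltW.
  by rewrite ler_nat; exact: ltnW.
by rewrite ger0_norm; lra.
Qed.

(** Subtracting a suitable multiple of n ^ gamma absorbs the error: on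
    balanced pairs the power with exponent gamma < 1 is subadditive with a
    definite gain. *)
Lemma near_superadditive_cvg (a : nat -> R) (B C gamma : R) :
  0 <= gamma < 1 -> 0 <= C ->
  (forall m n, (0 < m)%N -> (0 < n)%N -> (n <= 2 * m)%N -> (m <= 2 * n)%N ->
     a m + a n - C * (m + n)%:R `^ gamma <= a (m + n)%N) ->
  (forall n, (0 < n)%N -> a n <= B * n%:R) ->
  exists l : R, (a n / n%:R) @[n --> \oo] --> l.
Proof.
move=> /andP[g0 g1] C0 sa ub.
pose t : R := (2 / 3) `^ (gamma - 1).
have t1 : 1 < t.
  rewrite /t /powR; case: eqP => [|_]; first lra.
  rewrite expR_gt1 nmulr_rgt0; last lra.
  by apply: ln_lt0; lra.
pose K := C / (t - 1).
have K0 : 0 <= K by apply: divr_ge0; lra.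
have KC : K * (t - 1) = C by rewrite /K divfK// gt_eqF//; lra.
have gain m n : (0 < m)%N -> (0 < n)%N -> (n <= 2 * m)%N -> (m <= 2 * n)%N ->
    t * (m + n)%:R `^ gamma <= m%:R `^ gamma + n%:R `^ gamma.
  move=> m0 n0 nm mn.
  have s0 : 0 < (m + n)%:R :> R by rewrite ltr0n addn_gt0 m0.
  have piece k : (0 < k)%N -> (3 * k <= 2 * (m + n))%N ->
      k%:R * (t * (m + n)%:R `^ (gamma - 1)) <= k%:R `^ gamma.
    move=> k0 hk; have rk : 0 < k%:R :> R by rewrite ltr0n.
    have -> : (k%:R : R) `^ gamma = k%:R * k%:R `^ (gamma - 1).
      rewrite -[X in X * _]powRr1 ?(ltW rk)// -powRD; last by rewrite (gt_eqF rk) implybT.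
      by congr (_ `^ _); ring.
    rewrite ler_wpM2l ?(ltW rk)// /t -powRM ?divr_ge0 ?(ltW s0)//.
    apply: powR_le_neg => //; first by lra.
    have : 3 * k%:R <= 2 * (m + n)%:R :> R by rewrite -!natrM ler_nat.
    lra.
  have -> : t * (m + n)%:R `^ gamma =
      m%:R * (t * (m + n)%:R `^ (gamma - 1)) + n%:R * (t * (m + n)%:R `^ (gamma - 1)).
    rewrite -mulrDl -natrD mulrCA; congr (_ * _).
    rewrite -[X in X * _]powRr1 ?(ltW s0)// -powRD; last by rewrite (gt_eqF s0) implybT.
    by congr (_ `^ _); ring.
  by apply: lerD; apply: piece => //; lia.
pose b n := a n - K * n%:R `^ gamma.
have [l hl] : exists l : R, (b n / n%:R) @[n --> \oo] --> l.
  apply: (@balanced_superadditive_cvg b B) => [m n m0 n0 nm mn|n n0].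
    have := sa m n m0 n0 nm mn; have := ler_wpM2l K0 (gain m n m0 n0 nm mn).
    rewrite /b -KC; lra.
  by rewrite /b; have := ub n n0; have := mulr_ge0 K0 (powR_ge0 n%:R gamma); lra.
exists l.
have h : (b n / n%:R + K * n%:R `^ (gamma - 1)) @[n --> \oo] --> l + K * 0.
  by apply: cvgD hl _; apply: cvgMr; apply: powR_nat_cvg0; lra.
rewrite mulr0 addr0 in h; apply: cvg_trans h; apply: near_eq_cvg.
exists 1%N => // n /= n0; have rn : 0 < n%:R :> R by rewrite ltr0n.
rewrite /b mulrBl -mulrA.
suff -> : n%:R `^ gamma / n%:R = (n%:R : R) `^ (gamma - 1) by ring.
by rewrite powRB ?(gt_eqF rn) ?implybT// powRr1// ltW.
Qed.

End Fekete.

(** * Tails of the Pareto couplings *)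

Section ParetoTails.
Variables (R : realType) (alpha : R).
Hypothesis alpha0 : 0 < alpha.
Local Notation mu := (@lebesgue_measure R).

Lemma powR_continuous_at (r x : R) : 0 < x -> {for x, continuous (fun y : R => y `^ r)}.
Proof.
move=> x0; apply: differentiable_continuous; apply/derivable1_diffP.
by apply: derivable_powR; rewrite in_itv /= x0.
Qed.

Lemma integral_powR_tail (b : R) : 0 < b ->
  (\int[mu]_(x in `[b, +oo[) (alpha / 2 * x `^ (- (alpha + 1)))%:E =
  (b `^ (- alpha) / 2)%:E)%E.
Proof.
move=> b0.
rewrite (@ge0_continuous_FTC2y _ _ (fun x => - (2^-1 * x `^ (- alpha))) _ 0)//.
- by rewrite sub0e EFinN oppeK mulrC.
- by move=> x _; rewrite mulr_ge0 ?powR_ge0// divr_ge0// ltW.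
- apply/continuous_within_itvcyP; split.
    move=> x; rewrite in_itv /= andbT => bx.
    by apply: cvgMr; apply: powR_continuous_at; lra.
  apply: cvg_at_right_filter.
  by apply: cvgMr; exact: powR_continuous_at.
- rewrite -oppr0 -(mulr0 (2^-1 : R)); apply: cvgN; apply: cvgMr.
  by apply: powR_cvgy0; rewrite oppr_lt0.
- move=> x bx; apply: derivableN; apply: derivableM => //.
  by apply: derivable_powR; rewrite in_itv /= andbT; lra.
- apply: cvgN; apply: cvg_at_right_filter.
  by apply: cvgMr; exact: powR_continuous_at.
- move=> x; rewrite in_itv /= andbT => bx; have x0 : 0 < x by lra.
  rewrite derive1E.
  have d := @is_derive1_powR R (- alpha) x x0.
  have d2 := is_deriveN (is_deriveZ 2^-1 d).
  rewrite (@derive_val _ _ _ _ _ _ _ d2).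
  rewrite (_ : - (alpha + 1) = - alpha - 1); last by ring.
  by rewrite /GRing.scale /=; ring.
Qed.

Lemma integral_pareto_right (b : R) : 0 < b ->
  (\int[mu]_(x in [set x | (b <= x)%R]) (pareto_pdf alpha x)%:E =
  ((Num.max b 1) `^ (- alpha) / 2)%:E)%E.
Proof.
move=> b0; have m0 : 0 < Num.max b 1 by rewrite lt_max b0.
rewrite -integral_powR_tail// integral_mkcond [RHS]integral_mkcond.
congr integral; apply/funext => x; rewrite !patchE.
have -> : (x \in [set y | (b <= y)%R]) = (b <= x) by apply/idP/idP; rewrite inE.
rewrite mem_setE in_itv /= andbT ge_max /pareto_pdf; have [bx|//] := leP b x.
by rewrite ger0_norm; [case: (leP 1 x)|lra].
Qed.

Lemma integral_pareto_left (b : R) : 0 < b ->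
  (\int[mu]_(x in [set x | (x <= - b)%R]) (pareto_pdf alpha x)%:E =
  ((Num.max b 1) `^ (- alpha) / 2)%:E)%E.
Proof.
move=> b0; have m0 : 0 < Num.max b 1 by rewrite lt_max b0.
rewrite -integral_powR_tail//.
transitivity (\int[mu]_(x in `]-oo, (- Num.max b 1)%R])
    (alpha / 2 * (- x) `^ (- (alpha + 1)))%:E)%E.
  rewrite integral_mkcond [RHS]integral_mkcond.
  congr integral; apply/funext => x; rewrite !patchE.
  have -> : (x \in [set y | (y <= - b)%R]) = (b <= - x).
    by rewrite lerNr; apply/idP/idP; rewrite inE.
  rewrite mem_setE in_itv /= [x <= - Num.max _ _]lerNr ge_max /pareto_pdf.
  have [bx|//] := leP b (- x).
  by rewrite -normrN ger0_norm; [case: (leP 1 (- x))|lra].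
rewrite (@ge0_integration_by_substitutionNy _ (fun x => alpha / 2 * (- x) `^ (- (alpha + 1)))).
- by apply: eq_integral => x _ /=; rewrite opprK.
- have c x : x < 0 -> {for x, continuous (fun y : R => alpha / 2 * (- y) `^ (- (alpha + 1)))}.
    move=> x0; apply: cvgMr.
    apply: (@continuous_comp _ _ _ (@GRing.opp R) (fun y : R => y `^ (- (alpha + 1)))).
      exact: opp_continuous.
    by apply: powR_continuous_at; lra.
  apply/continuous_within_itvNycP; split.
    by move=> x; rewrite in_itv /= => xb; apply: c; lra.
  by apply: cvg_at_left_filter; apply: c; lra.
- by move=> x _; rewrite mulr_ge0 ?powR_ge0// divr_ge0// ltW.
Qed.

Lemma law_right (c a : R) : 0 < c -> 0 < a ->
  scaled_pareto_law alpha c [set x | (a <= x)%R] =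
  ((Num.max (a / c) 1) `^ (- alpha) / 2)%:E.
Proof.
move=> c0 a0; rewrite -integral_pareto_right ?divr_gt0// /scaled_pareto_law.
by congr integral; apply/seteqP; split => x /=; rewrite ler_pdivrMr// mulrC.
Qed.

Lemma law_left (c a : R) : 0 < c -> 0 < a ->
  scaled_pareto_law alpha c [set x | (x <= - a)%R] =
  ((Num.max (a / c) 1) `^ (- alpha) / 2)%:E.
Proof.
move=> c0 a0; rewrite -integral_pareto_left ?divr_gt0// /scaled_pareto_law.
congr integral; apply/seteqP; split => x /=;
  by rewrite -mulNr ler_pdivlMr// mulrC.
Qed.

End ParetoTails.

(** * Random variables with finitely many values *)

Section FiniteValued.
Variables (d : measure_display) (T : measurableType d) (R : realType).
Variables (P : probability T R).

Lemma fatou_le (f : nat -> T -> R) (g : T -> R) (B : R) :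
  (forall k, measurable_fun setT (f k)) -> (forall k w, 0 <= f k w) ->
  (forall w, f k w @[k --> \oo] --> g w) ->
  (forall k, (\int[P]_w (f k w)%:E <= B%:E)%E) ->
  (\int[P]_w (g w)%:E <= B%:E)%E.
Proof.
move=> mf f0 fg fB.
have mfE k : measurable_fun setT (fun w => (f k w)%:E : \bar R) by exact/measurable_EFinP.
have f0E k w : setT w -> (0 <= (f k w)%:E)%E by move=> _; rewrite lee_fin.
have := fatou P measurableT mfE f0E.
rewrite (eq_integral (fun w => (g w)%:E)); last first.
  move=> w _; have h : (f k w)%:E @[k --> \oo] --> (g w)%:E.
    by apply: cvg_EFin; [exact: nearW|exact: fg].
  by have [-> _] := cvg_limn_einf_sup h.
move=> /le_trans; apply; rewrite limn_einf_lim; apply: lime_le.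
  exact: is_cvg_einfs.
apply: nearW => k; apply: le_trans (fB k).
by apply: ereal_inf_lbound; exists k => //=.
Qed.

Variables (V : finType) (Y : T -> V).
Hypothesis mY : forall v, measurable (Y @^-1` [set v]).

Definition point_mass (v : V) : R := fine (P (Y @^-1` [set v])).

Lemma finite_valued_sum (f : V -> R) w : f (Y w) = \sum_v f v * \1_(Y @^-1` [set v]) w.
Proof.
rewrite (bigD1 (Y w))//= indicE mem_set// mulr1 big1 ?addr0// => v vY.
by rewrite indicE memNset ?mulr0//= => /esym/eqP; rewrite (negbTE vY).
Qed.

Lemma finite_valued_measurable (f : V -> R) : measurable_fun setT (fun w => f (Y w)).
Proof.
have -> : (fun w => f (Y w)) = fun w => \sum_v f v * \1_(Y @^-1` [set v]) w.
  by apply/funext => w; exact: finite_valued_sum.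
by apply: measurable_sum => v; exact: measurable_funM.
Qed.

Lemma finite_valued_integral (f : V -> R) :
  (\int[P]_w (f (Y w))%:E)%E = (\sum_v f v * point_mass v)%:E.
Proof.
transitivity (\int[P]_w (\sum_v (f v)%:E * (\1_(Y @^-1` [set v]) w)%:E))%E.
  apply: eq_integral => w _; rewrite finite_valued_sum -sumEFin.
  by apply: eq_bigr => v _; rewrite EFinM.
have ii v : P.-integrable setT (fun w => (\1_(Y @^-1` [set v]) w)%:E : \bar R).
  exact: integrable_indic.
rewrite integral_sum//; last by move=> v; exact: integrableZl.
rewrite -sumEFin; apply: eq_bigr => v _.
rewrite integralZl// integral_indic// setIT EFinM /point_mass fineK//.
exact: fin_num_measure.
Qed.

Lemma point_mass_law : is_law point_mass.
Proof.
split=> [v|]; first by rewrite fine_ge0.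
apply: EFin_inj; have := finite_valued_integral (fun=> 1).
rewrite integral_cst// mul1e [LHS](@probability_setT _ _ _ P) => h.
by rewrite h; congr EFin; apply: eq_bigr => v _; rewrite mul1r.
Qed.

End FiniteValued.

(** * Discretisation of a real coupling *)

Section Discretisation.
Variable R : realType.

(** A sign (true for negative) and a multiple of the mesh.  Zero has two codes;
    this makes the reversal of the sign a bijection of the grid. *)
Definition grid m := (bool * 'I_m.+1)%type.

Section Grid.
Variables (h : R) (m : nat).
Hypothesis h0 : 0 < h.

Definition grid_val (v : grid m) : R := (if v.1 then -1 else 1) * (v.2%:R * h).
Definition grid_neg (v : grid m) : grid m := (~~ v.1, v.2).
Definition grid0 : grid m := (false, ord0).

(** Rounding towards zero; values beyond the range of the grid are sent to
    zero as well, which keeps the map norm-decreasing. *)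
Definition round (x : R) : grid m :=
  let k := Num.truncn (`|x| / h) in (x < 0, inord (if (k <= m)%N then k else 0%N)).

Lemma grid_val0 : grid_val grid0 = 0.
Proof. by rewrite /grid_val /= mul0r mulr0. Qed.

Lemma grid_negK : involutive grid_neg.
Proof. by case=> s j; rewrite /grid_neg /= negbK. Qed.

Lemma grid_valN v : grid_val (grid_neg v) = - grid_val v.
Proof. by case: v => [[] j]; rewrite /grid_val /grid_neg /=; ring. Qed.

Lemma grid_val_norm v : `|grid_val v| = v.2%:R * h.
Proof.
by case: v => [[] j]; rewrite /grid_val /= normrM ?normrN ?normr1 mul1r ger0_norm//;
   rewrite mulr_ge0// ltW.
Qed.

Lemma grid_val_eq0 v : (grid_val v == 0) = (v.2 == 0%N :> nat).
Proof. by rewrite -normr_eq0 grid_val_norm mulf_eq0 (gt_eqF h0) orbF pnatr_eq0. Qed.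

Lemma round_le x : `|grid_val (round x)| <= `|x|.
Proof.
rewrite grid_val_norm /round /=; case: ifPn => [km|_].
  rewrite inordK ?ltnS// -ler_pdivlMr//.
  by have /andP[] := truncn_itv (divr_ge0 (normr_ge0 x) (ltW h0)).
by rewrite inordK// mul0r.
Qed.

Lemma round_dist x : `|x| < m.+1%:R * h -> `|grid_val (round x) - x| <= h.
Proof.
move=> xm.
have := truncn_itv (divr_ge0 (normr_ge0 x) (ltW h0)); rewrite /grid_val /round /=.
set k := Num.truncn _ => /andP[k1 k2].
have km : (k <= m)%N by rewrite truncn_le_nat ltr_pdivrMr.
rewrite km inordK ?ltnS//.
move: k1 k2; rewrite ler_pdivlMr// ltr_pdivrMr// -natr1 => k1 k2.
have [x0|x0] := ltP x 0.
  by move: k1 k2; rewrite ltr0_norm// ler_norml => k1 k2; apply/andP; split; lra.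
by move: k1 k2; rewrite ger0_norm// ler_norml => k1 k2; apply/andP; split; lra.
Qed.

Lemma round_cell_pos (j : 'I_m.+1) : (0 < j)%N ->
  round @^-1` [set (false, j)] =
  [set x | (j%:R * h <= x)%R] `\` [set x | (j.+1%:R * h <= x)%R].
Proof.
move=> j0; have jh : 0 < j%:R * h by rewrite mulr_gt0// ltr0n.
apply/seteqP; split => x /=.
  rewrite /round; set k := Num.truncn _; move=> [/negbT]; rewrite -leNgt => x0 jE.
  have := truncn_itv (divr_ge0 (normr_ge0 x) (ltW h0)); rewrite -/k => /andP[].
  have kE : (if (k <= m)%N then k else 0%N) = j :> nat.
    by rewrite -jE inordK//; case: ifP.
  have kj : k = j by move: kE j0; case: ifP => // _ <-.
  rewrite kj ler_pdivlMr// ltr_pdivrMr// ger0_norm// => h1 h2.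
  by split => //; apply/negP; rewrite -ltNge.
move=> [h1 /negP]; rewrite -ltNge => h2; have x0 : 0 <= x by lra.
have kj : Num.truncn (`|x| / h) = j.
  by apply: truncn_def; rewrite ger0_norm// ler_pdivlMr// ltr_pdivrMr// h1.
rewrite /round kj ltNge x0 /= -ltnS ltn_ord; congr pair.
by apply/val_inj; rewrite /= inordK.
Qed.

Lemma round_cell_neg (j : 'I_m.+1) : (0 < j)%N ->
  round @^-1` [set (true, j)] =
  [set x | (x <= - (j%:R * h))%R] `\` [set x | (x <= - (j.+1%:R * h))%R].
Proof.
move=> j0; have jh : 0 < j%:R * h by rewrite mulr_gt0// ltr0n.
have sw x : x != 0 -> (round x == (true, j)) = (round (- x) == (false, j)).
  move=> xn0; rewrite /round normrN !xpair_eqE; congr (_ && _).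
  by rewrite oppr_lt0 [x < 0]lt_neqAle xn0 /= leNgt; case: (0 < x).
have := round_cell_pos j0 => /seteqP[c1 c2].
apply/seteqP; split => x /=.
  move=> xE; have xn : x < 0 by move: xE; rewrite /round => -[->].
  have := c1 (- x); rewrite /= => /(_ _)[].
    by apply/eqP; rewrite -sw ?lt_eqF//; apply/eqP.
  by move=> h1 h2; split; [rewrite lerNr|rewrite lerNr].
rewrite ![x <= _]lerNr => -[h1 h2]; apply/eqP; rewrite sw; last first.
  by rewrite lt_eqF//; lra.
by apply/eqP; apply: c2.
Qed.

Lemma round_measurable v : measurable (round @^-1` [set v]).
Proof.
have mr (a : R) : measurable [set x | (a <= x)%R].
  by rewrite (_ : [set x | _] = `[a, +oo[%classic)// set_itvE.
have ml (a : R) : measurable [set x | (x <= a)%R].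
  by rewrite (_ : [set x | _] = `]-oo, a]%classic)// set_itvE.
have pos (s : bool) (j : 'I_m.+1) : (0 < j)%N -> measurable (round @^-1` [set (s, j)]).
  move=> j0; case: s; first by rewrite round_cell_neg//; exact: measurableD.
  by rewrite round_cell_pos//; exact: measurableD.
case: v => s j; have [j0|] := posnP j; last exact: pos.
have mn : measurable [set x : R | x < 0].
  by rewrite (_ : [set x | _] = `]-oo, 0[%classic)// set_itvE.
have -> : round @^-1` [set (s, j)] =
    [set x : R | (x < 0) == s] `\`
    \bigcup_(i in [set i : 'I_m.+1 | (0 < i)%N]) round @^-1` [set (s, i)].
  apply/seteqP; split => x /=.
    move=> xE; split; first by move: xE => [->].
    by move=> [i /= i0 iE]; move: i0; rewrite iE in xE; case: xE => ->; rewrite j0.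
  move=> [/eqP xs hx]; have [r0|r0] := posnP (round x).2.
    by move: r0 xs; rewrite /round /= => r0 <-; congr pair; apply/val_inj; rewrite /= r0.
  by exfalso; apply: hx; exists (round x).2 => //=; rewrite -xs.
apply: measurableD; last by apply: fin_bigcup_measurable => // i; exact: pos.
case: s.
  by rewrite (_ : [set x | _] = [set x : R | x < 0])//; apply/seteqP; split => x /= /eqP.
rewrite (_ : [set x | _] = ~` [set x : R | x < 0]); first exact: measurableC.
by apply/seteqP; split => x /=; [move/eqP => -> |move/negP/negbTE ->].
Qed.

End Grid.

(** Along this sequence the mesh goes to 0 and the range to infinity, while
    eps stays a multiple of the mesh: no cell straddles the cutoff. *)
Definition mesh (eps : R) (k : nat) : R := eps / k.+1%:R.
Definition grid_range (k : nat) : nat := (k.+1 ^ 2)%N.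

Lemma mesh_gt0 eps k : 0 < eps -> 0 < mesh eps k.
Proof. by move=> e0; rewrite divr_gt0. Qed.

Lemma round_cvg eps x : 0 < eps ->
  grid_val (mesh eps k) (@round (mesh eps k) (grid_range k) x) @[k --> \oo] --> x.
Proof.
move=> e0; apply/cvgrPdist_le => /= e ep.
exists (Num.bound (`|x| / eps) + Num.bound (eps / e))%N => // k /= hk.
have k0 : 0 < k.+1%:R :> R by [].
have hx : `|x| / eps < k.+1%:R.
  apply: lt_le_trans (archi_boundP _) _; first by rewrite divr_ge0// ltW.
  by rewrite ler_nat (leq_trans _ (leqW hk))// leq_addr.
have he : eps / e < k.+1%:R.
  apply: lt_le_trans (archi_boundP _) _; first by rewrite divr_ge0// ltW.
  by rewrite ler_nat (leq_trans _ (leqW hk))// leq_addl.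
rewrite distrC; apply: le_trans (round_dist (mesh_gt0 k e0) _) _.
  rewrite /mesh /grid_range; apply: lt_trans (_ : k.+1%:R * eps < _).
    by rewrite -ltr_pdivrMr.
  rewrite mulrA mulrAC ltr_pM2r// ltr_pdivlMr//.
  by rewrite -natrM ltr_nat mulnn.
rewrite /mesh ler_pdivrMr// mulrC -ler_pdivrMr//; exact: ltW.
Qed.

End Discretisation.

(** * The discretised Pareto law *)

Section DiscretePareto.
Variables (R : realType) (alpha : R).
Hypothesis alpha0 : 0 < alpha.

Definition disc_weight (c h : R) m (v : grid m) : R :=
  fine (scaled_pareto_law alpha c (@round R h m @^-1` [set v])).

Variables (d : measure_display) (T : measurableType d) (P : probability T R).
Variables (Y : T -> R) (c h : R) (m : nat).
Hypothesis mY : measurable_fun setT Y.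
Hypothesis c0 : 0 < c.
Hypothesis h0 : 0 < h.
Hypothesis hY : forall A : set R, measurable A ->
  P (Y @^-1` A) = scaled_pareto_law alpha c A.

Local Notation w := (@disc_weight c h m).
Local Notation tailT a := ((Num.max (a / c) 1) `^ (- alpha) / 2).

Let mpre (A : set R) : measurable A -> measurable (Y @^-1` A).
Proof. by move=> mA; rewrite -[X in measurable X]setTI; exact: mY. Qed.

Let mr (a : R) : measurable [set x | (a <= x)%R].
Proof. by rewrite (_ : [set x | _] = `[a, +oo[%classic)// set_itvE. Qed.

Let ml (a : R) : measurable [set x | (x <= a)%R].
Proof. by rewrite (_ : [set x | _] = `]-oo, a]%classic)// set_itvE. Qed.

Let Pdiff (A B : set R) : measurable A -> measurable B -> B `<=` A ->
  P (Y @^-1` (A `\` B)) = (P (Y @^-1` A) - P (Y @^-1` B))%E.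
Proof.
move=> mA mB BA.
have -> : Y @^-1` (A `\` B) = (Y @^-1` A) `\` (Y @^-1` B) by [].
rewrite measureD; [|exact: mpre..|by rewrite ltey_eq fin_num_measure//; exact: mpre].
by congr (_ - P _)%E; rewrite setIidr// => x; exact: BA.
Qed.

Lemma round_preimage_measurable v : measurable ((fun t => @round R h m (Y t)) @^-1` [set v]).
Proof. exact: (mpre (round_measurable h0 v)). Qed.

Lemma disc_weightE v : w v = point_mass P (fun t => @round R h m (Y t)) v.
Proof. by rewrite /disc_weight -hY//; exact: round_measurable. Qed.

Lemma disc_weight_law : is_law w.
Proof.
have [p0 p1] := point_mass_law P round_preimage_measurable.
split=> [v|]; first by rewrite disc_weightE.
by rewrite -[RHS]p1; apply: eq_bigr => v _; rewrite disc_weightE.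
Qed.

Lemma disc_weight_cell s (j : 'I_m.+1) : (0 < j)%N ->
  w (s, j) = tailT (j%:R * h) - tailT (j.+1%:R * h).
Proof.
move=> j0; have a0 : 0 < j%:R * h by rewrite mulr_gt0// ltr0n.
have b0 : 0 < j.+1%:R * h by rewrite mulr_gt0.
have jj : j%:R * h <= j.+1%:R * h by rewrite ler_wpM2r ?ler_nat// ltW.
rewrite /disc_weight -hY; last exact: round_measurable.
case: s; [rewrite round_cell_neg//|rewrite round_cell_pos//].
  rewrite Pdiff//; first by rewrite !hY// !law_left.
  by move=> x /= hx; lra.
rewrite Pdiff//; first by rewrite !hY// !law_right.
by move=> x /= hx; lra.
Qed.

Lemma disc_weight_tail (a : R) : 0 < a ->
  \sum_(v | a <= `|grid_val h v|) w v <= c `^ alpha * a `^ (- alpha).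
Proof.
move=> a0.
pose f (v : grid m) : R := (a <= `|grid_val h v|)%R%:R.
have -> : \sum_(v | a <= `|grid_val h v|) w v =
    \sum_v f v * point_mass P (fun t => @round R h m (Y t)) v.
  rewrite big_mkcond; apply: eq_bigr => v _; rewrite -disc_weightE /f.
  by case: ifP; rewrite ?mul1r ?mul0r.
rewrite -lee_fin -(finite_valued_integral P round_preimage_measurable).
pose A := Y @^-1` [set x | (a <= x)%R]; pose B := Y @^-1` [set x | (x <= - a)%R].
have mA : measurable A by exact: mpre.
have mB : measurable B by exact: mpre.
apply: (@le_trans _ _ (\int[P]_t (\1_(A `|` B) t)%:E)%E).
  apply: ge0_le_integral => //.
  - by move=> t _; rewrite lee_fin.
  - by apply/measurable_EFinP; exact: (finite_valued_measurable round_preimage_measurable).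
  - by apply/measurable_EFinP; apply: measurable_indic; exact: measurableU.
  - move=> t _; rewrite lee_fin /f; case: (boolP (a <= _)) => // ha.
    have hYt := le_trans ha (round_le m h0 (Y t)).
    rewrite indicE mem_set ?ler01//=; move: hYt.
    have [y0|y0] := ltP (Y t) 0; last by rewrite ger0_norm//; left.
    by rewrite ltr0_norm// lerNr; right.
rewrite integral_indic ?setIT//; last exact: measurableU.
apply: le_trans (measureU2 _ _ _) _ => //.
have PA : P A = (tailT a)%:E by rewrite -law_right// -hY.
have PB : P B = (tailT a)%:E by rewrite -law_left// -hY.
apply: (@le_trans _ _ ((tailT a)%:E + (tailT a)%:E)%E).
  by apply: leeD; rewrite le_eqVlt; apply/orP; left; apply/eqP.
rewrite -EFinD lee_fin.
have mx : (Num.max (a / c) 1) `^ (- alpha) <= (a / c) `^ (- alpha).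
  by apply: powR_le_neg; rewrite ?oppr_le0 ?(ltW alpha0) ?divr_gt0// le_max lexx.
have -> : c `^ alpha * a `^ (- alpha) = (a / c) `^ (- alpha).
  rewrite powRM ?invr_ge0 ?(ltW a0) ?(ltW c0)// mulrC; congr (_ * _).
  by rewrite -powR_inv1 ?(ltW c0)// -powRrM mulrNN mul1r.
lra.
Qed.

Lemma disc_weight_sym (b : R) : 0 < b ->
  symmetric_weight (fun v => b * grid_val h v) (@grid_neg m) w.
Proof.
move=> b0 [s j]; rewrite mulf_eq0 (gt_eqF b0) /= grid_val_eq0//= => j0.
by rewrite /grid_neg /= !disc_weight_cell// lt0n.
Qed.

(** Above the natural scale c the weight is c ^ alpha times a quantity that
    does not depend on c: this is what makes systems of different sizes
    comparable. *)
Lemma disc_weight_large s (j : 'I_m.+1) : c <= j%:R * h ->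
  w (s, j) = c `^ alpha * (((j%:R * h) `^ (- alpha) - (j.+1%:R * h) `^ (- alpha)) / 2).
Proof.
move=> cj; have a0 : 0 < j%:R * h by apply: lt_le_trans cj.
have j0 : (0 < j)%N by move: a0; rewrite pmulr_lgt0// ltr0n.
have b0 : 0 < j.+1%:R * h by rewrite mulr_gt0.
have jj : j%:R * h <= j.+1%:R * h by rewrite ler_wpM2r ?ler_nat// ltW.
have e x : 0 < x -> c <= x -> (Num.max (x / c) 1) `^ (- alpha) = c `^ alpha * x `^ (- alpha).
  move=> x0 cx; rewrite max_l; last by rewrite ler_pdivlMr// mul1r.
  rewrite powRM ?invr_ge0 ?(ltW x0) ?(ltW c0)// mulrC; congr (_ * _).
  by rewrite -powR_inv1 ?(ltW c0)// -powRrM mulrNN mul1r.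
by rewrite disc_weight_cell// !e//; [ring|lra].
Qed.

End DiscretePareto.

(** * The model in finite volume *)

Section PowerContinuity.
Variable R : realType.

Lemma cvg_powR_nonneg (p : R) (y : nat -> R) (l : R) : 0 < p ->
  (forall k, 0 <= y k) -> y @ \oo --> l -> (y k `^ p) @[k --> \oo] --> l `^ p.
Proof.
move=> p0 y0 yl.
have l0 : 0 <= l by apply: (ler_cvg_to (cvg_cst (0 : R)) yl); exact: nearW.
have [l1|l2] := ltP 0 l.
  apply: (@cvg_comp _ _ _ y (fun z : R => z `^ p) _ (nbhs l)); first exact: yl.
  exact: powR_continuous_at.
have -> : l = 0 by apply/eqP; rewrite eq_le l2 l0.
rewrite powR0 ?gt_eqF//; apply/cvgrPdist_le => /= e e0.
have c0 : 0 < e `^ p^-1 by exact: powR_gt0.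
have /cvgrPdist_le/(_ _ c0) := yl; apply: filterS => k.
have -> : l = 0 by apply/eqP; rewrite eq_le l2 l0.
rewrite !sub0r !normrN !ger0_norm ?powR_ge0// => h.
have -> : e = (e `^ p^-1) `^ p by rewrite -powRrM mulVf ?gt_eqF// powRr1// ltW.
by rewrite ge0_ler_powR ?nnegrE// ltW.
Qed.

End PowerContinuity.

Section FiniteVolume.
Variables (R : realType) (alpha beta : R) (N : nat).
Hypothesis halpha : 1 < alpha < 2.
Hypothesis hbeta : 0 < beta.
Hypothesis N0 : (0 < N)%N.
Variables (d : measure_display) (T : measurableType d) (P : probability T R).
Variable J : 'I_N -> 'I_N -> {RV P >-> R}.
Hypothesis hJ : levy_couplings alpha J.

Local Notation edge := ('I_N * 'I_N)%type.
Local Notation theta := (N%:R `^ (- alpha^-1) : R).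

Let alpha0 : 0 < alpha. Proof. by have := halpha; lra. Qed.

Lemma scale_gt0 : 0 < theta.
Proof. by rewrite powR_gt0// ltr0n. Qed.

Lemma scale_powR : theta `^ alpha = N%:R^-1.
Proof. by rewrite -powRrM mulNr mulVf ?gt_eqF// powR_inv1// ler0n. Qed.

Let Jlaw (e : edge) (A : set R) : upper e -> measurable A ->
  P (J e.1 e.2 @^-1` A) = scaled_pareto_law alpha theta A.
Proof. by move=> ue mA; case: hJ => hl _; rewrite -(hl e.1 e.2 ue A mA). Qed.

Let Jind : mutually_independent (upper_pairs N) (fun e : edge => J e.1 e.2).
Proof. by case: hJ. Qed.

Section Mesh.
Variables (h : R) (m : nat).
Hypothesis h0 : 0 < h.

Definition rounded (t : T) : {ffun edge -> grid m} :=
  [ffun e => if upper e then @round R h m (J e.1 e.2 t) else @grid0 m].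

Let w := @disc_weight R alpha theta h m.

Let cell_measurable e v : measurable (J e.1 e.2 @^-1` (@round R h m @^-1` [set v])).
Proof.
rewrite -[X in measurable X]setTI; apply: measurable_funP => //.
exact: round_measurable.
Qed.

Let rounded_preimage (x : {ffun edge -> grid m}) : (forall e, ~~ upper e -> x e = @grid0 m) ->
  rounded @^-1` [set x] = \bigcap_(e in [set` upper_pairs N])
     J e.1 e.2 @^-1` (@round R h m @^-1` [set x e]).
Proof.
move=> hx; apply/seteqP; split => t /=.
  by move=> <- e /=; rewrite inE ffunE /upper => ->.
move=> ht; apply/ffunP => e; rewrite ffunE; case: ifPn => ue; last by rewrite hx.
by apply: (ht e); rewrite /= inE.
Qed.

Let rounded_empty (x : {ffun edge -> grid m}) e : ~~ upper e -> x e != @grid0 m ->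
  rounded @^-1` [set x] = set0.
Proof.
move=> ue xe; apply/seteqP; split => t //= tx.
by move: xe; rewrite -tx ffunE (negbTE ue) eqxx.
Qed.

Lemma rounded_measurable x : measurable (rounded @^-1` [set x]).
Proof.
have [hx|/existsNP[e /not_implyP[ue /eqP xe]]] :=
  pselect (forall e, ~~ upper e -> x e = @grid0 m).
  by rewrite rounded_preimage//; exact: fin_bigcap_measurable.
by rewrite (rounded_empty ue xe).
Qed.

(** Frozen entries are deterministic; for the others this is independence,
    applied to all upper pairs at once. *)
Lemma rounded_mass x :
  point_mass P rounded x = \prod_e edge_law (@grid0 m) w e (x e).
Proof.
rewrite /point_mass.
have [hx|/existsNP[e /not_implyP[ue /eqP xe]]] :=
  pselect (forall e, ~~ upper e -> x e = @grid0 m).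
  rewrite rounded_preimage// (Jind (F := upper_pairs N)
    (B := fun e => @round R h m @^-1` [set x e]))//; last first.
    by move=> e _; exact: round_measurable.
  rewrite (eq_bigr (fun e => (edge_law (@grid0 m) w e (x e))%:E)); last first.
    move=> e; rewrite inE => ue.
    rewrite Jlaw//; last exact: round_measurable.
    rewrite /edge_law /upper ue /w /disc_weight fineK//.
    by rewrite -(@Jlaw e)//; [exact: fin_num_measure|exact: round_measurable].
  rewrite prodEFin /= big_mkcond; apply: eq_bigr => e _.
  case: ifPn => //; rewrite inE => ue.
  by rewrite /edge_law /upper (negbTE ue) hx// eqxx.
rewrite (rounded_empty ue xe) measure0 /= (bigD1 e)//= /edge_law (negbTE ue).
by rewrite (negbTE xe) mul0r.
Qed.

Lemma integral_rounded (f : {ffun edge -> grid m} -> R) :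
  (\int[P]_t (f (rounded t))%:E)%E = (pmean (edge_law (@grid0 m) w) f)%:E.
Proof.
rewrite (finite_valued_integral P rounded_measurable) /pmean; congr EFin.
by apply: eq_bigr => x _; rewrite rounded_mass mulrC.
Qed.

End Mesh.

(** A deterministic form in which true and rounded couplings can be
    compared. *)
Definition log_Z (x : edge -> R) : R :=
  ln (Zfun (@ising_chi R N) (fun e => beta * (if upper e then x e else 0))).

Lemma log_partitionE t : log_partition beta J t = log_Z (fun e => J e.1 e.2 t).
Proof.
rewrite /log_partition /log_Z /partition_function /Zfun; congr ln.
apply: eq_bigr => s _; rewrite /boltzmann sum_pairE mulr_sumr; congr expR.
apply: eq_bigr => i _; rewrite mulr_sumr big_mkcond; apply: eq_bigr => j _.
rewrite /upper /=; case: ifP => _; last by rewrite mulr0 mul0r.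
by rewrite /ising_chi /pair_chi /ising_sig /= !mulrA.
Qed.

Lemma log_Z_lipschitz x y : `|log_Z x - log_Z y| <= beta * \sum_(e | upper e) `|x e - y e|.
Proof.
apply: le_trans (ln_Zfun_lipschitz [ffun=> false] (pair_chi2 (@ising_sig2 R N)) _ _) _.
rewrite mulr_sumr [leRHS]big_mkcond; apply: ler_sum => e _; case: ifP => _.
  by rewrite -mulrBr normrM gtr0_norm.
by rewrite subrr normr0.
Qed.

Lemma log_Z_rounded (h : R) m t :
  log_Z (fun e => grid_val h (@round R h m (J e.1 e.2 t))) =
  logZ (@ising_chi R N) (fun v => beta * grid_val h v) (rounded h m t).
Proof.
rewrite /log_Z /logZ; congr (ln (Zfun _ _)); apply/funext => e.
by rewrite ffunE; case: ifP => // _; rewrite grid_val0.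
Qed.

Definition moment_const (q : R) : R := 1 + 2 * (2 `^ q / (1 - 2 `^ (q - alpha))).

Lemma edge_moment (h : R) m (e : edge) (q : R) : 0 < h -> 0 < q < alpha -> upper e ->
  \sum_v @disc_weight R alpha theta h m v * `|grid_val h v| `^ q <=
  moment_const q * theta `^ q.
Proof.
move=> h0 /andP[q0 qa] ue.
have mY : measurable_fun setT (J e.1 e.2 : T -> R) by [].
have law := fun A mA => @Jlaw e A ue mA.
have [w0 w1] := disc_weight_law m mY h0 law.
have tail := disc_weight_tail alpha0 m mY scale_gt0 h0 law.
apply: (full_moment w0 _ (powR_ge0 theta alpha) tail _ scale_gt0).
- by [].
- by rewrite (ltW q0).
- by rewrite w1.
- by have := powR_ge0 theta alpha; lra.
Qed.

(** Only the moments of the rounded couplings have been computed; they are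
    bounded uniformly in the mesh, and Fatou's lemma does the rest. *)
Lemma coupling_integrable (e : edge) : upper e ->
  P.-integrable setT (fun t => (J e.1 e.2 t)%:E).
Proof.
move=> ue; apply/integrableP; split; first exact/measurable_EFinP.
apply: (@le_lt_trans _ _ (moment_const 1 * theta)%:E); last exact: ltry.
apply: (@fatou_le _ _ _ _ (fun k t =>
  `|grid_val (mesh 1 k) (@round R (mesh 1 k) (grid_range k) (J e.1 e.2 t))|)).
- move=> k; have hm := mesh_gt0 k (@ltr01 R).
  have mY : measurable_fun setT (J e.1 e.2 : T -> R) by [].
  exact: (finite_valued_measurable (round_preimage_measurable (m := grid_range k) mY hm)
    (fun v => `|grid_val (mesh 1 k) v|)).
- by [].
- by move=> t; apply: cvg_norm; exact: round_cvg.
- move=> k; have hm := mesh_gt0 k (@ltr01 R).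
  have mY : measurable_fun setT (J e.1 e.2 : T -> R) by [].
  have law := fun A mA => @Jlaw e A ue mA.
  rewrite (finite_valued_integral P (round_preimage_measurable (m := grid_range k) mY hm)
    (fun v => `|grid_val (mesh 1 k) v|)) lee_fin.
  have a1 : 0 < (1 : R) < alpha by rewrite ltr01; case/andP: halpha.
  have := edge_moment (grid_range k) hm a1 ue.
  rewrite powRr1 ?(ltW scale_gt0)//; apply: le_trans.
  rewrite le_eqVlt; apply/orP; left; apply/eqP; apply: eq_bigr => v _.
  by rewrite powRr1// mulrC (disc_weightE hm law).
Qed.

Definition mean_free_energy : R := fine ('E_P[log_partition beta J])%E.

Definition discrete_energy (eps : R) (k : nat) : R :=
  free_energy (fun v => beta * grid_val (mesh eps k) v) (@grid0 (grid_range k)) N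
    (@disc_weight R alpha theta (mesh eps k) (grid_range k)).

Lemma log_partition_approx eps t : 0 < eps ->
  logZ (@ising_chi R N) (fun v => beta * grid_val (mesh eps k) v)
    (rounded (mesh eps k) (grid_range k) t) @[k --> \oo] --> log_partition beta J t.
Proof.
move=> e0; rewrite log_partitionE.
apply/cvgrPdist_le => /= e ep.
have : (beta * \sum_(i | upper i)
    `|J i.1 i.2 t -
      grid_val (mesh eps k) (@round R (mesh eps k) (grid_range k) (J i.1 i.2 t))|)
    @[k --> \oo] --> beta * \sum_(i : edge | upper i) (0 : R).
  apply: cvgMr; apply: cvg_big => [|i _]; first exact: add_continuous.
  apply/norm_cvg0P; rewrite -(subrr (J i.1 i.2 t)).
  by apply: cvgB; [exact: cvg_cst|exact: round_cvg].
rewrite big1 // mulr0 => /cvgrPdist_le/(_ _ ep); apply: filterS => k.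
rewrite sub0r normrN => h; rewrite -log_Z_rounded.
by apply: le_trans (log_Z_lipschitz _ _) _; apply: le_trans (ler_norm _) h.
Qed.

Lemma log_partition_dominated eps k t : 0 < eps ->
  `|logZ (@ising_chi R N) (fun v => beta * grid_val (mesh eps k) v)
    (rounded (mesh eps k) (grid_range k) t)| <=
  `|log_Z (fun=> 0)| + \sum_(e | upper e) beta * `|J e.1 e.2 t|.
Proof.
move=> e0; rewrite -log_Z_rounded -mulr_sumr.
set z := log_Z (fun e => _).
have -> : z = log_Z (fun=> 0) + (z - log_Z (fun=> 0)) by ring.
apply: le_trans (ler_normD _ _) _; rewrite lerD2l.
apply: le_trans (log_Z_lipschitz _ _) _; rewrite ler_pM2l//.
by apply: ler_sum => e _; rewrite subr0; apply: round_le; exact: mesh_gt0.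
Qed.

Lemma rounded_fun_measurable eps k f : 0 < eps ->
  measurable_fun setT (fun t => f (rounded (mesh eps k) (grid_range k) t) : R).
Proof.
move=> e0; apply: finite_valued_measurable.
by apply: rounded_measurable; exact: mesh_gt0.
Qed.

Lemma log_partition_measurable : measurable_fun setT (log_partition beta J : T -> R).
Proof.
apply: (@measurable_fun_cvg _ _ _ setT (fun k t =>
  logZ (@ising_chi R N) (fun v => beta * grid_val (mesh 1 k) v)
    (rounded (mesh 1 k) (grid_range k) t))) => //.
  by move=> k; exact: rounded_fun_measurable.
by move=> t _; exact: log_partition_approx.
Qed.

(** Rounding towards zero does not increase the couplings, so the rounded
    log-partition functions share an integrable Lipschitz bound. *)
Lemma log_partition_limit eps : 0 < eps ->
  P.-integrable setT (fun t => (log_partition beta J t)%:E) /\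
  (\int[P]_t (logZ (@ising_chi R N) (fun v => beta * grid_val (mesh eps k) v)
    (rounded (mesh eps k) (grid_range k) t))%:E)%E @[k --> \oo] -->
  (\int[P]_t (log_partition beta J t)%:E)%E.
Proof.
move=> e0.
have ig : P.-integrable setT (fun t =>
    (`|log_Z (fun=> 0)| + \sum_(e | upper e) beta * `|J e.1 e.2 t|)%:E).
  under eq_fun do rewrite EFinD -sumEFin.
  apply: integrableD => //; first exact: finite_measure_integrable_cst.
  apply: integrable_sum => // e ue; under eq_fun do rewrite EFinM.
  by apply: integrableZl => //; apply: integrable_norm; exact: coupling_integrable.
have [] := @dominated_convergence _ T R P setT measurableT
  (fun k t => (logZ (@ising_chi R N) (fun v => beta * grid_val (mesh eps k) v)
    (rounded (mesh eps k) (grid_range k) t))%:E)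
  (fun t => (log_partition beta J t)%:E) _ _ _ _ ig _ => //.
- by move=> k; apply/measurable_EFinP; exact: rounded_fun_measurable.
- by apply/measurable_EFinP; exact: log_partition_measurable.
- by apply: aeW => t _; apply: cvg_EFin; [exact: nearW|exact: log_partition_approx].
- by apply: aeW => t k _; rewrite lee_fin; exact: log_partition_dominated.
Qed.

Lemma mean_free_energyE : ('E_P[log_partition beta J] = mean_free_energy%:E)%E.
Proof.
rewrite /mean_free_energy fineK// unlock.
have [h _] := log_partition_limit (@ltr01 R).
exact: integrable_fin_num.
Qed.

Lemma discrete_energy_cvg eps : 0 < eps ->
  discrete_energy eps k @[k --> \oo] --> mean_free_energy.
Proof.
move=> e0; have [_ h] := log_partition_limit e0.
have : (discrete_energy eps k)%:E @[k --> \oo] --> mean_free_energy%:E.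
  rewrite -mean_free_energyE unlock; apply: cvg_trans h.
  apply: near_eq_cvg; apply: nearW => k.
  by rewrite integral_rounded//; exact: mesh_gt0.
by move=> /fine_cvgP[_].
Qed.

Definition concentration_const (p : R) : R :=
  16 * (beta `^ p * moment_const p + (beta * moment_const 1) `^ p).

(** The bound for rounded couplings does not depend on the mesh, and the powers
    of the centred quantities converge pointwise. *)
Lemma log_partition_concentration p : 1 < p < alpha ->
  (\int[P]_t (`|log_partition beta J t - mean_free_energy| `^ p)%:E <=
   (N%:R ^+ 2 * (concentration_const p * theta `^ p))%:E)%E.
Proof.
move=> /andP[p1 pa]; have p0 : 0 < p by lra.
have hp : 1 < p <= 2 by rewrite p1; case/andP: halpha => *; lra.
pose f k (x : {ffun edge -> grid (grid_range k)}) :=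
  logZ (@ising_chi R N) (fun v => beta * grid_val (mesh 1 k) v) x.
apply: (@fatou_le _ _ _ _ (fun k t =>
  `|f k (rounded (mesh 1 k) (grid_range k) t) - discrete_energy 1 k| `^ p)).
- by move=> k; exact: (@rounded_fun_measurable 1 k
    (fun x => `|f k x - discrete_energy 1 k| `^ p) ltr01).
- by move=> k t; exact: powR_ge0.
- move=> t; apply: cvg_powR_nonneg => //; apply: cvg_norm; apply: cvgB.
    exact: log_partition_approx.
  exact: discrete_energy_cvg.
move=> k; have hm := mesh_gt0 k (@ltr01 R).
rewrite (integral_rounded hm (fun x => `|f k x - discrete_energy 1 k| `^ p)) lee_fin.
set w := @disc_weight R alpha theta (mesh 1 k) (grid_range k).
have elaw (e : edge) : is_law (edge_law (@grid0 (grid_range k)) w e).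
  rewrite /edge_law; case: (boolP (upper e)) => ue; last exact: delta_law.
  have mY : measurable_fun setT (J e.1 e.2 : T -> R) by [].
  exact: (disc_weight_law (grid_range k) mY hm (fun A mA => @Jlaw e A ue mA)).
pose g (v : grid (grid_range k)) := `|beta * grid_val (mesh 1 k) v|.
have mc q : 0 < q < alpha -> 0 <= moment_const q.
  move=> /andP[q0 qa]; rewrite addr_ge0// mulr_ge0// divr_ge0 ?powR_ge0//.
  have /andP[_ ?] : 0 < (2 : R) `^ (q - alpha) < 1 by apply: powR_2lt1; lra.
  lra.
have t0 := scale_gt0.
have emom q (e : edge) : 0 < q < alpha ->
    \sum_v edge_law (@grid0 (grid_range k)) w e v * g v `^ q <=
    beta `^ q * (moment_const q * theta `^ q).
  move=> hq; have /andP[q0 qa] := hq.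
  rewrite /edge_law; case: (boolP (upper e)) => ue; last first.
    rewrite (sum_delta _ (fun v => g v `^ q)) /g grid_val0 mulr0 normr0 powR0 ?gt_eqF//.
    by rewrite !mulr_ge0 ?powR_ge0 ?mc.
  have := edge_moment (grid_range k) hm hq ue => hE.
  apply: le_trans (ler_wpM2l (powR_ge0 beta q) hE); rewrite mulr_sumr.
  apply: ler_sum => v _; rewrite /g normrM powRM// (gtr0_norm hbeta).
  by rewrite le_eqVlt; apply/orP; left; apply/eqP; rewrite /w; ring.
have a1 : 0 < (1 : R) < alpha by rewrite ltr01; case/andP: halpha.
have hpa : 0 < p < alpha by rewrite p0.
have := @pmean_concentration R _ _ (edge_law (@grid0 (grid_range k)) w) g p elaw _ hp
  (fun=> beta * moment_const 1 * theta)
  (fun=> beta `^ p * (moment_const p * theta `^ p)) _ _ (f k) _.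
have -> : pmean (edge_law (@grid0 (grid_range k)) w) (f k) = discrete_energy 1 k by [].
move=> H; apply: le_trans (H _ _ _ _) _.
- by move=> v; exact: normr_ge0.
- move=> e; have := emom 1 e a1; rewrite !powRr1 ?(ltW t0) ?(ltW hbeta)// mulrA.
  by apply: le_trans; apply: ler_sum => v _; rewrite powRr1 ?normr_ge0.
- by move=> e; exact: emom.
- move=> x e v; exact: (@logZ_lipschitz R _ _ _ (@ising_chi R N)
    (fun v => beta * grid_val (mesh 1 k) v) [ffun=> false] (pair_chi2 (@ising_sig2 R N))).
apply: sum_edges_le => e.
rewrite /concentration_const powRM ?(ltW t0) ?mulr_ge0 ?mc ?(ltW hbeta)//.
by rewrite le_eqVlt; apply/orP; left; apply/eqP; ring.
Qed.

End FiniteVolume.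

(** * Superadditivity of the mean free energy *)

Lemma sum_split_lt (R : realType) (V : finType) (g : V -> R) (b : R) (F : V -> R) :
  \sum_v F v = \sum_(v | g v < b) F v + \sum_(v | b <= g v) F v.
Proof.
rewrite (bigID (fun v => g v < b))/=; congr (_ + _).
by apply: eq_bigl => v; rewrite -leNgt.
Qed.

Section Energies.
Variables (R : realType) (alpha beta : R).
Hypothesis halpha : 1 < alpha < 2.
Hypothesis hbeta : 0 < beta.
Variables (d : measure_display) (T : measurableType d) (P : probability T R).
Variable X : T -> R.
Hypothesis mX : measurable_fun setT X.
Hypothesis hX : forall A : set R, measurable A -> P (X @^-1` A) = scaled_pareto_law alpha 1 A.

Local Notation scale n := (n%:R `^ (- alpha^-1) : R).

Let alpha0 : 0 < alpha. Proof. by have := halpha; lra. Qed.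
Let a1 : 1 < alpha. Proof. by case/andP: halpha. Qed.
Let a2 : alpha < 2. Proof. by case/andP: halpha. Qed.

Let Y c t := c * X t.

Let mY c : measurable_fun setT (Y c).
Proof. exact: measurable_funM. Qed.

Let hY c (A : set R) : measurable A -> P (Y c @^-1` A) = scaled_pareto_law alpha c A.
Proof.
move=> mA; have mcA : measurable ((fun x : R => c * x) @^-1` A).
  rewrite -[X in measurable X]setTI.
  have : measurable_fun setT (fun x : R => c * x) by exact: measurable_funM.
  exact.
have := hX mcA; rewrite /scaled_pareto_law /= => ->.
by congr integral; apply/seteqP; split => x /=; rewrite mul1r.
Qed.

Section Weights.
Variables (n : nat) (h : R) (m : nat).
Hypothesis n0 : (0 < n)%N.
Hypothesis h0 : 0 < h.

Local Notation w := (@disc_weight R alpha (scale n) h m).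

Let rn : 0 < n%:R :> R. Proof. by rewrite ltr0n. Qed.

Let s0 : 0 < scale n. Proof. exact: scale_gt0. Qed.

Lemma weight_law : is_law w.
Proof. exact: (disc_weight_law m (mY _) h0 (hY _)). Qed.

Lemma weight_tail (a : R) : 0 < a ->
  \sum_(v | a <= `|grid_val h v|) w v <= n%:R^-1 * a `^ (- alpha).
Proof.
move=> a0'; have := disc_weight_tail alpha0 m (mY (scale n)) s0 h0 (hY (scale n)) a0'.
by rewrite (scale_powR n halpha).
Qed.

Lemma weight_sym : symmetric_weight (fun v => beta * grid_val h v) (@grid_neg m) w.
Proof. exact: (disc_weight_sym alpha0 (mY (scale n)) s0 h0 (hY (scale n)) hbeta). Qed.

Definition small_const : R := 2 `^ alpha / (1 - 2 `^ (alpha - 2%:R)).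
Definition large_const : R := 2 `^ 1 / (1 - 2 `^ (1 - alpha)).

(** Small couplings enter through ln cosh y <= 2 y ^ 2, whose integral near
    zero converges since alpha < 2. *)
Lemma weight_small (eps : R) : 0 < eps ->
  \sum_(v | `|grid_val h v| < eps) w v * ln (cosh (beta * grid_val h v)) <=
  n%:R^-1 * (2 * beta ^+ 2 * small_const * eps `^ (2 - alpha)).
Proof.
move=> e0; have [w0 w1] := weight_law.
have A0 : 0 <= (n%:R : R)^-1 by rewrite invr_ge0 ltW.
have g0 (v : grid m) : 0 <= `|grid_val h v| by [].
have q2 : alpha < 2%:R by exact: a2.
have := small_moment w0 g0 A0 alpha0 weight_tail q2 e0.
rewrite -/small_const => H.
apply: (@le_trans _ _ (2 * beta ^+ 2 *
    \sum_(v | `|grid_val h v| < eps) w v * `|grid_val h v| `^ 2%:R)).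
  rewrite mulr_sumr; apply: ler_sum => v _.
  rewrite [leRHS]mulrCA ler_wpM2l//; apply: le_trans (ln_cosh_le_sqr _) _.
  by rewrite powR_mulrn// real_normK ?num_real// exprMn mulrA.
have b0 : 0 <= 2 * beta ^+ 2 by rewrite mulr_ge0 ?sqr_ge0.
apply: le_trans (ler_wpM2l b0 H) _.
by rewrite le_eqVlt; apply/orP; left; apply/eqP; ring.
Qed.

(** Large couplings enter through ln cosh y <= |y|, whose integral at infinity
    converges since 1 < alpha. *)
Lemma weight_large (eps : R) : 0 < eps ->
  \sum_(v | eps <= `|grid_val h v|) w v * ln (cosh (beta * grid_val h v)) <=
  n%:R^-1 * (beta * large_const * eps `^ (1 - alpha)).
Proof.
move=> e0; have [w0 w1] := weight_law.
have A0 : 0 <= (n%:R : R)^-1 by rewrite invr_ge0 ltW.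
have g0 (v : grid m) : 0 <= `|grid_val h v| by [].
have q1 : 0 <= (1 : R) < alpha by rewrite ler01 a1.
have := large_moment w0 g0 A0 weight_tail q1 e0.
rewrite -/large_const => H.
apply: (@le_trans _ _ (beta *
    \sum_(v | eps <= `|grid_val h v|) w v * `|grid_val h v| `^ 1)).
  rewrite mulr_sumr; apply: ler_sum => v _.
  rewrite [leRHS]mulrCA ler_wpM2l//; apply: le_trans (ln_cosh_le_norm _) _.
  by rewrite powRr1// normrM gtr0_norm.
apply: le_trans (ler_wpM2l (ltW hbeta) H) _.
by rewrite le_eqVlt; apply/orP; left; apply/eqP; ring.
Qed.

End Weights.

Local Notation energy n eps k := (discrete_energy alpha beta n eps k).

Lemma discrete_energy_upper n k : (0 < n)%N ->
  energy n 1 k <= (ln 2 + (2 * beta ^+ 2 * small_const + beta * large_const)) * n%:R.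
Proof.
move=> n0; have hm := mesh_gt0 k (@ltr01 R).
have rn : 0 < n%:R :> R by rewrite ltr0n.
have v0 : beta * grid_val (mesh 1 k) (@grid0 (grid_range k)) = 0 by rewrite grid_val0 mulr0.
have vN v : beta * grid_val (mesh 1 k) (@grid_neg (grid_range k) v) =
    - (beta * grid_val (mesh 1 k) v).
  by rewrite grid_valN mulrN.
have := free_energy_le v0 (@grid_negK _) vN n (weight_law n (grid_range k) hm)
  (weight_sym (m := grid_range k) n0 hm).
move=> /le_trans; apply; rewrite mulrDl [n%:R * _]mulrC lerD2l.
rewrite (sum_split_lt (fun v => `|grid_val (mesh 1 k) v|) 1).
have h1 := weight_small (grid_range k) n0 hm (@ltr01 R).
have h2 := weight_large (grid_range k) n0 hm (@ltr01 R).
rewrite !powR1 !mulr1 in h1 h2.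
have n2 : 0 <= (n%:R : R) ^+ 2 by rewrite sqr_ge0.
apply: le_trans (ler_wpM2l n2 (lerD h1 h2)) _.
rewrite le_eqVlt; apply/orP; left; apply/eqP; field; exact: lt0r_neq0.
Qed.

(** With this exponent dropping the couplings below the cutoff costs the order
    of phi; the cost of the interpolation, which grows with the density of the
    couplings that are kept, stays below that.  The factor 3 puts the cutoff
    above the natural scale of both blocks, each of which contains at least a
    third of the sites. *)
Definition cutoff (n : nat) : R := 3 * n%:R `^ (- (1 + 3 * alpha)^-1).

Definition super_const : R :=
  2 * beta ^+ 2 * small_const * 3 `^ (2 - alpha) +
  9 * beta * large_const * 3 `^ (1 - 2 * alpha) + 1.

Lemma small_const_ge0 : 0 <= small_const.
Proof.
have /andP[_ r1] : 0 < (2 : R) `^ (alpha - 2%:R) < 1.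
  by apply: powR_2lt1; rewrite subr_lt0; exact: a2.
by apply: divr_ge0; [exact: powR_ge0|lra].
Qed.

Lemma large_const_ge0 : 0 <= large_const.
Proof.
have /andP[_ r1] : 0 < (2 : R) `^ (1 - alpha) < 1 by apply: powR_2lt1; rewrite subr_lt0.
by apply: divr_ge0; [exact: powR_ge0|lra].
Qed.

Lemma super_const_gt0 : 0 < super_const.
Proof.
have := small_const_ge0; have := large_const_ge0 => c1 c2.
have b0 := ltW hbeta.
apply: ltr_wpDl => //; apply: addr_ge0; apply: mulr_ge0; rewrite ?powR_ge0//.
  by apply: mulr_ge0 => //; rewrite mulr_ge0 ?sqr_ge0.
by apply: mulr_ge0 => //; rewrite mulr_ge0.
Qed.

Section Cutoff.
Variable n : nat.
Hypothesis n0 : (0 < n)%N.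
Let rn : 0 < n%:R :> R. Proof. by rewrite ltr0n. Qed.
Let n1 : 1 <= n%:R :> R. Proof. by rewrite ler1n. Qed.
Let den0 : 0 < 1 + 3 * alpha. Proof. by have := alpha0; lra. Qed.

Lemma cutoff_gt0 : 0 < cutoff n.
Proof. by rewrite mulr_gt0// powR_gt0. Qed.

Lemma cutoff_powR (r : R) :
  cutoff n `^ r = 3 `^ r * n%:R `^ (- r / (1 + 3 * alpha)).
Proof.
rewrite powRM ?powR_ge0// -powRrM; congr (_ * _ `^ _).
by rewrite !mulNr [_^-1 * _]mulrC.
Qed.

Lemma cutoff_scale M : (0 < M)%N -> (n <= 3 * M)%N -> scale M <= cutoff n.
Proof.
move=> M0 nM; have rM : 0 < M%:R :> R by rewrite ltr0n.
have nM' : n%:R <= 3 * M%:R :> R by rewrite -natrM ler_nat.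
apply: (@le_trans _ _ ((n%:R / 3) `^ (- alpha^-1))).
  apply: powR_le_neg; first by rewrite oppr_le0 invr_ge0 ltW.
    by rewrite divr_gt0.
  by rewrite ler_pdivrMr// mulrC.
rewrite powRM ?invr_ge0// ?(ltW rn)// /cutoff mulrC; apply: ler_pM; rewrite ?powR_ge0//.
  rewrite -powR_inv1// -powRrM mulrNN mul1r -[leRHS](@powRr1 _ 3)//.
  apply: ler_powR; first by rewrite ler1n.
  by rewrite invf_le1// ltW.
apply: ler_powR => //; rewrite lerN2 lef_pV2 ?posrE//; first by have := alpha0; lra.
Qed.

Lemma cutoff_rate : 3 / n%:R * cutoff n `^ (- alpha) <= 1.
Proof.
rewrite cutoff_powR.
have h1 : 3 * 3 `^ (- alpha) <= 1 :> R.
  rewrite -[X in X * _](@powRr1 _ 3)// -powRD; last by rewrite pnatr_eq0 implybT.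
  rewrite -[leRHS](powRr0 (3 : R)); apply: ler_powR; first by rewrite ler1n.
  by have := a1; lra.
have h2 : n%:R^-1 * n%:R `^ (- - alpha / (1 + 3 * alpha)) <= 1 :> R.
  rewrite -[X in X * _]powR_inv1 ?(ltW rn)// -powRD; last by rewrite (gt_eqF rn) implybT.
  rewrite -[leRHS](powRr0 (n%:R : R)); apply: ler_powR => //.
  rewrite opprK -lerBrDl sub0r opprK ler_pdivrMr// mul1r.
  by have := alpha0; lra.
have -> : 3 / n%:R * (3 `^ (- alpha) * n%:R `^ (- - alpha / (1 + 3 * alpha))) =
  (3 * 3 `^ (- alpha)) * (n%:R^-1 * n%:R `^ (- - alpha / (1 + 3 * alpha))) :> R by ring.
by rewrite mulr_ile1 ?mulr_ge0 ?powR_ge0 ?invr_ge0.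
Qed.

Lemma cutoff_phi_small : n%:R * cutoff n `^ (2 - alpha) = 3 `^ (2 - alpha) * phi alpha n%:R.
Proof.
rewrite cutoff_powR mulrCA; congr (_ * _); rewrite /phi.
rewrite -[X in X * _]powRr1 ?(ltW rn)// -powRD; last by rewrite (gt_eqF rn) implybT.
by congr (_ `^ _); rewrite mulNr.
Qed.

Lemma cutoff_phi_large : cutoff n `^ (1 - 2 * alpha) <= 3 `^ (1 - 2 * alpha) * phi alpha n%:R.
Proof.
rewrite cutoff_powR ler_wpM2l ?powR_ge0// /phi; apply: ler_powR => //.
rewrite -subr_ge0.
have -> : 1 - (2 - alpha) / (1 + 3 * alpha) - - (1 - 2 * alpha) / (1 + 3 * alpha) =
   2 * alpha / (1 + 3 * alpha) by field; exact: lt0r_neq0.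
by rewrite divr_ge0 ?mulr_ge0// ltW.
Qed.

End Cutoff.

(** The jump weight is n = M + N times the discretised law of the system of
    size n above the cutoff; by scaling it is also M times and N times the
    corresponding laws of the two blocks. *)
Lemma discrete_energy_superadditive M N k : (0 < M)%N -> (0 < N)%N ->
  (N <= 2 * M)%N -> (M <= 2 * N)%N ->
  energy M (cutoff (M + N)) k + energy N (cutoff (M + N)) k <=
  energy (M + N)%N (cutoff (M + N)) k + super_const * phi alpha (M + N)%:R.
Proof.
move=> M0 N0 NM MN; pose n := (M + N)%N.
have n0 : (0 < n)%N by rewrite addn_gt0 M0.
pose eps := cutoff n.
have e0 : 0 < eps by exact: cutoff_gt0.
have hm := mesh_gt0 k e0.
pose h := mesh eps k; pose m := grid_range k.
pose g (v : grid m) := `|grid_val h v|.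
pose w p := @disc_weight R alpha (scale p) h m.
pose ell v := if eps <= g v then n%:R * w n v else 0.
have rM : 0 < M%:R :> R by rewrite ltr0n.
have rN : 0 < N%:R :> R by rewrite ltr0n.
have rn : 0 < n%:R :> R by rewrite ltr0n.
have wl p : is_law (w p) by exact: weight_law.
have w0 p v : 0 <= w p v by case: (wl p).
have ell0 v : 0 <= ell v by rewrite /ell; case: ifP => // _; rewrite mulr_ge0// ltW.
have ws p : (0 < p)%N -> symmetric_weight (fun v => beta * grid_val h v) (@grid_neg m) (w p).
  by move=> p0; exact: weight_sym.
have ell_sym : symmetric_weight (fun v => beta * grid_val h v) (@grid_neg m) ell.
  move=> v vn0; rewrite /ell (ws n n0 v vn0).
  by rewrite /g grid_valN normrN.
have v0 : beta * grid_val h (@grid0 m) = 0 by rewrite grid_val0 mulr0.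
have vN v : beta * grid_val h (@grid_neg m v) = - (beta * grid_val h v).
  by rewrite grid_valN mulrN.
(* the natural scales of all three systems lie below the cutoff *)
have common p v : (0 < p)%N -> (n <= 3 * p)%N -> eps <= g v -> n%:R * w n v = p%:R * w p v.
  move=> p0 np; case: v => s j ev.
  have {}ev : eps <= j%:R * h by have := ev; rewrite /g (grid_val_norm hm).
  have sc q : (0 < q)%N -> (n <= 3 * q)%N -> scale q <= j%:R * h.
    by move=> q0 nq; apply: le_trans ev; exact: cutoff_scale.
  have E q : (0 < q)%N -> (n <= 3 * q)%N -> q%:R * w q (s, j) =
      ((j%:R * h) `^ (- alpha) - (j.+1%:R * h) `^ (- alpha)) / 2.
    move=> q0 nq; have rq : q%:R != 0 :> R by rewrite pnatr_eq0 -lt0n.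
    rewrite /w (disc_weight_large alpha0 (mY (scale q)) (scale_gt0 _ q0) hm
      (hY (scale q)) s (sc q q0 nq)).
    by rewrite (scale_powR q halpha) mulrA divff// mul1r.
  by rewrite (E n n0 (leq_pmull n (ltn0Sn 2))) (E p p0 np).
have ell_le p v : (0 < p)%N -> (n <= 3 * p)%N -> ell v / p%:R <= w p v.
  move=> p0 np; rewrite /ell; case: ifP => ev; last by rewrite mul0r.
  by rewrite (common p)// mulrC mulKf// pnatr_eq0 -lt0n.
have nn : (n <= 3 * n)%N by rewrite leq_pmull.
have nM : (n <= 3 * M)%N by rewrite /n; lia.
have nN : (n <= 3 * N)%N by rewrite /n; lia.
have sum_ell : \sum_v ell v <= eps `^ (- alpha).
  rewrite /ell -big_mkcond -mulr_sumr -ler_pdivlMl//.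
  exact: weight_tail.
have aM p : (0 < p)%N -> (n <= 3 * p)%N -> p%:R^-1 <= 3 / n%:R :> R.
  move=> p0 np; have rp : 0 < p%:R :> R by rewrite ltr0n.
  rewrite ler_pdivlMr// mulrC ler_pdivrMr//.
  by rewrite -natrM ler_nat.
have a3 : 0 <= 3 / n%:R :> R by rewrite divr_ge0// ltW.
have aL : 3 / n%:R * \sum_v ell v <= 1.
  by apply: le_trans (ler_wpM2l a3 sum_ell) _; exact: cutoff_rate.
have := free_energy_superadditive v0 (@grid_negK m) vN ell0 ell_sym M0 N0
  (wl n) (wl M) (wl N) (ws n n0) (ws M M0) (ws N N0)
  (fun v => ell_le n v n0 nn) (fun v => ell_le M v M0 nM) (fun v => ell_le N v N0 nN)
  (aM M M0 nM) (aM N N0 nN) aL.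
have small p : (0 < p)%N -> (n <= 3 * p)%N ->
    p%:R ^+ 2 * small_part (fun v => beta * grid_val h v) ell p (w p) <=
    p%:R * (2 * beta ^+ 2 * small_const * eps `^ (2 - alpha)).
  move=> p0 np; have rp : 0 < p%:R :> R by rewrite ltr0n.
  have H := weight_small m p0 hm e0.
  rewrite expr2 -mulrA ler_pM2l// -ler_pdivlMl//.
  apply: le_trans H; rewrite /small_part [leRHS]big_mkcond; apply: ler_sum => v _.
  rewrite -/(g v) /ell; case: (ltP (g v) eps) => ge; first by rewrite mul0r subr0.
  by rewrite (common p)// mulrC mulrAC divff ?mul1r ?subrr ?mulr0 ?gt_eqF.
have kap : ell_log_cosh (fun v => beta * grid_val h v) ell <=
    beta * large_const * eps `^ (1 - alpha).
  have H := weight_large m n0 hm e0.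
  rewrite ler_pdivlMl// in H; rewrite /ell_log_cosh; apply: le_trans H.
  rewrite mulr_sumr [leRHS]big_mkcond; apply: ler_sum => v _.
  rewrite -/(g v) -/(w n v) /ell; case: (leP eps (g v)) => _; first by rewrite [leRHS]mulrA.
  by rewrite mul0r.
have kap0 : 0 <= ell_log_cosh (fun v => beta * grid_val h v) ell.
  by apply: sumr_ge0 => v _; rewrite mulr_ge0// ln_cosh_ge0.
have L0 : 0 <= \sum_v ell v by apply: sumr_ge0.
have E3 : n%:R ^+ 2 * ((3 / n%:R) ^+ 2 * (\sum_v ell v) *
      ell_log_cosh (fun v => beta * grid_val h v) ell) <=
    9 * beta * large_const * 3 `^ (1 - 2 * alpha) * phi alpha n%:R.
  have -> : n%:R ^+ 2 * ((3 / n%:R) ^+ 2 * (\sum_v ell v) *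
      ell_log_cosh (fun v => beta * grid_val h v) ell) =
      9 * ((\sum_v ell v) * ell_log_cosh (fun v => beta * grid_val h v) ell).
    by field; exact: lt0r_neq0.
  have H := ler_pM L0 kap0 sum_ell kap.
  apply: (@le_trans _ _ (9 * (beta * large_const) * eps `^ (1 - 2 * alpha))).
    have -> : eps `^ (1 - 2 * alpha) = eps `^ (- alpha) * eps `^ (1 - alpha).
      rewrite -powRD; last by rewrite (gt_eqF e0) implybT.
      by rewrite (_ : - alpha + (1 - alpha) = 1 - 2 * alpha)//; ring.
    lra.
  have c0 : 0 <= 9 * (beta * large_const).
    by apply: mulr_ge0 => //; apply: mulr_ge0; [exact: ltW|exact: large_const_ge0].
  apply: le_trans (ler_wpM2l c0 (cutoff_phi_large n0)) _.
  by rewrite le_eqVlt; apply/orP; left; apply/eqP; ring.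
have E2 : (M%:R + N%:R) * (2 * beta ^+ 2 * small_const * eps `^ (2 - alpha)) =
    2 * beta ^+ 2 * small_const * 3 `^ (2 - alpha) * phi alpha n%:R.
  by rewrite -natrD -[RHS]mulrA -(cutoff_phi_small n0) -/n -/eps; ring.
have ph0 : 0 <= phi alpha n%:R :> R by exact: powR_ge0.
have sM := small M M0 nM; have sN := small N N0 nN.
move=> /le_trans; apply.
rewrite -!addrA lerD2l; apply: le_trans (lerD sM (lerD sN E3)) _.
by rewrite addrA -mulrDl E2 -mulrDl ler_wpM2r// /super_const lerDl.
Qed.

End Energies.

(** * Convergence in mean of order p *)

Section LpBound.
Variables (R : realType) (d : measure_display) (T : measurableType d).
Variables (P : probability T R).

(** Where |Y| <= eta its power p is at most eta ^ p, elsewhere at most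
    eta ^ (p - q) times its power q. *)
Lemma lower_moment (Y : T -> R) (p q eta a D : R) :
  measurable_fun setT Y -> 1 <= p <= 2 -> p <= q -> 0 < eta -> 0 <= D ->
  (\int[P]_t (`|Y t| `^ q)%:E <= D%:E)%E ->
  (\int[P]_t (`|Y t + a| `^ p)%:E <=
   (4 * (eta `^ p + `|a| `^ p + eta `^ (p - q) * D))%:E)%E.
Proof.
move=> mY hp pq e0 D0 hD; have /andP[p1 p2] := hp.
have mpow (Z : T -> R) (r : R) : measurable_fun setT Z ->
    measurable_fun setT (fun t => (`|Z t| `^ r)%:E).
  move=> mZ; apply/measurable_EFinP.
  apply: (@measurableT_comp _ _ _ _ _ _ (fun z : R => z `^ r)).
    exact: measurable_powR.
  exact: measurableT_comp.
have c0 : 0 <= 4 * (eta `^ p + `|a| `^ p) by rewrite mulr_ge0 ?addr_ge0 ?powR_ge0.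
have k0 : 0 <= 4 * eta `^ (p - q) by rewrite mulr_ge0 ?powR_ge0.
apply: (@le_trans _ _ (\int[P]_t ((4 * (eta `^ p + `|a| `^ p))%:E +
    (4 * eta `^ (p - q))%:E * (`|Y t| `^ q)%:E))%E).
  apply: ge0_le_integral => //.
  - by apply: mpow; exact: measurable_funD.
  - apply: emeasurable_funD; first exact: measurable_cst.
    by apply: emeasurable_funM; [exact: measurable_cst|exact: mpow].
  - move=> t _; rewrite -EFinM -EFinD lee_fin.
    apply: (@le_trans _ _ ((`|Y t| + `|a|) `^ p)).
      by rewrite ge0_ler_powR ?nnegrE ?addr_ge0 ?ler_normD//; lra.
    apply: le_trans (powRD_le hp (normr_ge0 _) (normr_ge0 _)) _.
    have : `|Y t| `^ p <= eta `^ p + eta `^ (p - q) * `|Y t| `^ q.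
      have [ye|ye] := leP `|Y t| eta.
        rewrite ler_wpDr ?mulr_ge0 ?powR_ge0//.
        by rewrite ge0_ler_powR ?nnegrE// ?ltW//; lra.
      have y0 : 0 < `|Y t| by apply: lt_trans ye.
      rewrite ler_wpDl ?powR_ge0//.
      have -> : `|Y t| `^ p = `|Y t| `^ (p - q) * `|Y t| `^ q.
        by rewrite -powRD ?subrK// (gt_eqF y0) implybT.
      rewrite ler_wpM2r ?powR_ge0//; apply: powR_le_neg => //; last exact: ltW.
      by rewrite subr_le0.
    lra.
rewrite ge0_integralD//; last 2 first.
- by move=> t _; rewrite mule_ge0// lee_fin ?powR_ge0.
- by apply: emeasurable_funM; [exact: measurable_cst|exact: mpow].
rewrite integral_cst// [X in (_ * X + _)%E](@probability_setT _ _ _ P) mule1.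
rewrite ge0_integralZl//; last exact: mpow.
apply: (@le_trans _ _ ((4 * (eta `^ p + `|a| `^ p))%:E + (4 * eta `^ (p - q))%:E * D%:E)%E).
  by rewrite leeD2l// lee_wpmul2l.
by rewrite -EFinM -EFinD lee_fin; lra.
Qed.

End LpBound.

Theorem theorem2p5 (R : realType) (alpha : R) (halpha : 1 < alpha < 2)
    (d : nat -> measure_display) (T : forall N : nat, measurableType (d N))
    (P : forall N : nat, probability (T N) R)
    (J : forall N : nat, 'I_N -> 'I_N -> {RV (P N) >-> R})
    (hJ : forall N : nat, (1 <= N)%N -> levy_couplings alpha (@J N))
    (beta : R) (hbeta : 0 < beta) :
  (exists C : R, 0 < C /\
     forall M N : nat, (1 <= M)%N -> (1 <= N)%N ->
       N%:R / 2 <= M%:R :> R -> M%:R <= 2 * N%:R :> R ->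
       ('E_(P (M + N)%N)[log_partition beta (@J (M + N)%N)] >=
        'E_(P M)[log_partition beta (@J M)] +
        'E_(P N)[log_partition beta (@J N)] -
        (C * phi alpha (M + N)%:R)%:E)%E) /\
  (exists l : R,
     (((N%:R^-1)%:E * 'E_(P N)[log_partition beta (@J N)])%E
        @[N --> \oo] --> l%:E) /\
     (forall p : R, 1 <= p -> p < alpha ->
        Lnorm (P N) p%:E (fun w : T N =>
          (N%:R^-1 * log_partition beta (@J N) w - l)%:E)
        @[N --> \oo] --> (0 : \bar R))).
Proof.
have /andP[a1 a2] := halpha.
have alpha0 : 0 < alpha by lra.
have den0 : 0 < 1 + 3 * alpha by lra.
(* a coupling of the system of size 2, rescaled, provides a variable with the
   unscaled Pareto law *)
pose c : R := 2%:R `^ alpha^-1.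
pose X (t : T 2) : R := c * @J 2 ord0 ord_max t.
have mX : measurable_fun setT X by exact: measurable_funM.
have hX (A : set R) : measurable A -> P 2 (X @^-1` A) = scaled_pareto_law alpha 1 A.
  move=> mA; have [h2 _] := hJ 2 isT.
  have mcA : measurable ((fun x : R => c * x) @^-1` A).
    rewrite -[X in measurable X]setTI.
    have : measurable_fun setT (fun x : R => c * x) by exact: measurable_funM.
    exact.
  have := h2 ord0 ord_max isT _ mcA; rewrite /scaled_pareto_law /=.
  rewrite (_ : distribution _ _ _ = P 2 (X @^-1` A))// => ->.
  congr integral; apply/seteqP; split => x /=;
    by rewrite mulrA /c -powRD ?subrr ?powRr0// pnatr_eq0 implybT.
pose F N := mean_free_energy beta (@J N).
have FE N : (0 < N)%N -> ('E_(P N)[log_partition beta (@J N)] = (F N)%:E)%E.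
  by move=> N0; exact: (mean_free_energyE halpha hbeta N0 (hJ N N0)).
have Fcvg N eps : (0 < N)%N -> 0 < eps ->
    discrete_energy alpha beta N eps k @[k --> \oo] --> F N.
  by move=> N0 e0; exact: (discrete_energy_cvg halpha hbeta N0 (hJ N N0) e0).
pose C := super_const alpha beta.
have C0 : 0 < C by exact: super_const_gt0.
have super M N : (0 < M)%N -> (0 < N)%N -> (N <= 2 * M)%N -> (M <= 2 * N)%N ->
    F M + F N - C * phi alpha (M + N)%:R <= F (M + N)%N.
  move=> M0 N0 NM MN; have n0 : (0 < M + N)%N by rewrite addn_gt0 M0.
  have e0 := cutoff_gt0 alpha n0.
  rewrite lerBlDr; apply: (ler_cvg_to (cvgD (Fcvg M _ M0 e0) (Fcvg N _ N0 e0))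
    (cvgD (Fcvg (M + N)%N _ n0 e0) (cvg_cst (C * phi alpha (M + N)%:R)))).
  apply: nearW => k /=.
  exact: (discrete_energy_superadditive halpha hbeta mX hX).
split.
  exists C; split => // M N M1 N1 NM MN.
  have NM' : (N <= 2 * M)%N.
    by rewrite -(ler_nat R) natrM; lra.
  have MN' : (M <= 2 * N)%N by rewrite -(ler_nat R) natrM.
  have n0 : (0 < M + N)%N by rewrite addn_gt0 M1.
  rewrite !FE//; have := super M N M1 N1 NM' MN'.
  by rewrite -lee_fin EFinB EFinD.
pose B := ln 2 + (2 * beta ^+ 2 * small_const alpha + beta * large_const alpha).
have ub N : (0 < N)%N -> F N <= B * N%:R.
  move=> N0; apply: (ler_cvg_to (Fcvg N _ N0 (@ltr01 R)) (cvg_cst (B * N%:R))).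
  by apply: nearW => k; exact: (discrete_energy_upper halpha hbeta mX hX).
have hgamma : 0 <= 1 - (2 - alpha) / (1 + 3 * alpha) < 1.
  rewrite subr_ge0 ler_pdivrMr// mul1r ltrBlDr ltrDl divr_gt0//; last lra.
  by rewrite andbT; lra.
have [l Fl] := near_superadditive_cvg hgamma (ltW C0) super ub.
exists l; split.
  apply: cvg_trans (_ : (F N / N%:R)%:E @[N --> \oo] --> l%:E); last first.
    by apply: cvg_EFin; [exact: nearW|exact: Fl].
  apply: near_eq_cvg; exists 1%N => // N /= N1.
  by rewrite FE// -EFinM mulrC.
move=> p p1 pa; have p0 : 0 < p by lra.
have p12 : 1 <= p <= 2 by rewrite p1; lra.
(* q < alpha is taken above p and above 2 alpha / (1 + alpha), so that
   N ^ (2 - q / alpha - q) tends to 0 *)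
pose q0 : R := Num.max p (2 * alpha / (1 + alpha)).
have q0a : q0 < alpha.
  rewrite gt_max pa /= ltr_pdivrMr; last lra.
  nra.
pose q : R := (q0 + alpha) / 2.
have q0p : p <= q0 by rewrite le_max lexx.
have q0q : 2 * alpha / (1 + alpha) <= q0 by rewrite le_max lexx orbT.
have pq : p < q by rewrite /q; lra.
have qa : q < alpha by rewrite /q; lra.
have q1 : 1 < q by lra.
pose r : R := q + q / alpha - 2%:R.
have r0 : 0 < r.
  have : 2 * alpha / (1 + alpha) < q by rewrite /q; lra.
  rewrite ltr_pdivrMr; last lra.
  move=> h; have E : r * alpha = q * (1 + alpha) - 2 * alpha.
    by rewrite /r; field; exact: lt0r_neq0.
  by rewrite -(pmulr_lgt0 _ alpha0) E subr_gt0.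
have qp0 : 0 < q - p by rewrite subr_gt0.
have qpn : q - p != 0 by exact: lt0r_neq0.
pose D := concentration_const alpha beta q.
(* eta loses half of the available power, so that both terms of
   [lower_moment] tend to 0 *)
pose eta N : R := N%:R `^ (- r / (2 * (q - p))).
pose b N : R := 4 * (eta N `^ p + `|F N / N%:R - l| `^ p + D * N%:R `^ (- r / 2)).
have b0 : b N @[N --> \oo] --> 0.
  have -> : 0 = 4 * (0 + 0 + D * 0) :> R by ring.
  apply: cvgMr; apply: cvgD; last first.
    by apply: cvgMr; apply: powR_nat_cvg0; rewrite mulNr oppr_lt0 divr_gt0.
  apply: cvgD.
    rewrite /eta; under eq_fun do rewrite -powRrM.
    by apply: powR_nat_cvg0; rewrite mulNr mulNr oppr_lt0 mulr_gt0// divr_gt0// mulr_gt0.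
  have -> : 0 = 0 `^ p :> R by rewrite powR0// gt_eqF.
  apply: cvg_powR_nonneg => //; rewrite -(normr0 R) -(subrr l).
  by apply: cvg_norm; apply: cvgB => //; exact: cvg_cst.
have bound N : (0 < N)%N ->
    (\int[P N]_w (`|N%:R^-1 * log_partition beta (@J N) w - l| `^ p)%:E <= (b N)%:E)%E.
  move=> N0; have rN : 0 < N%:R :> R by rewrite ltr0n.
  have Nn : (N%:R == 0 :> R) = false by rewrite gt_eqF.
  have iN : 0 <= (N%:R : R)^-1 by rewrite invr_ge0 ltW.
  have e0 : 0 < eta N by exact: powR_gt0.
  have mL := log_partition_measurable hbeta (@J N).
  pose Z w := log_partition beta (@J N) w - F N.
  have mZ : measurable_fun setT Z by exact: measurable_funB.
  pose Y w := N%:R^-1 * Z w.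
  have mY : measurable_fun setT Y by exact: measurable_funM.
  have hq : 1 < q < alpha by rewrite q1.
  have h := log_partition_concentration halpha hbeta N0 (hJ N N0) hq.
  have hD : (\int[P N]_w (`|Y w| `^ q)%:E <= (D * N%:R `^ (- r))%:E)%E.
    under eq_integral => w _ do rewrite /Y normrM (ger0_norm iN) powRM// EFinM.
    rewrite ge0_integralZl//; last first.
      apply/measurable_EFinP; apply: (@measurableT_comp _ _ _ _ _ _ (fun z : R => z `^ q)).
        exact: measurable_powR.
      exact: measurableT_comp.
    apply: le_trans (lee_wpmul2l _ h) _; first by rewrite lee_fin powR_ge0.
    rewrite -EFinM lee_fin -/D le_eqVlt; apply/orP; left; apply/eqP.
    have -> : - r = - q + (2%:R + (- alpha^-1 * q)) by rewrite /r; ring.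
    rewrite powRD ?Nn ?implybT// powRD ?Nn ?implybT// powR_mulrn ?(ltW rN)//.
    by rewrite -powR_inv1 ?(ltW rN)// -!powRrM mulN1r; ring.
  have DN0 : 0 <= D * N%:R `^ (- r).
    rewrite -lee_fin; apply: le_trans hD; apply: integral_ge0 => w _.
    by rewrite lee_fin powR_ge0.
  have := lower_moment (F N / N%:R - l) mY p12 (ltW pq) e0 DN0 hD.
  have -> : eta N `^ (p - q) * (D * N%:R `^ (- r)) = D * N%:R `^ (- r / 2).
    have -> : - r / 2 = - r / (2 * (q - p)) * (p - q) + (- r) by field.
    by rewrite [in RHS]powRD ?Nn ?implybT// /eta -powRrM; ring.
  apply: le_trans; rewrite le_eqVlt; apply/orP; left; apply/eqP.
  apply: eq_integral => w _; congr (`|_| `^ p)%:E.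
  by rewrite /Y /Z; ring.
have cb : (`|b N| `^ p^-1)%:E @[N --> \oo] --> (0 : \bar R).
  apply: cvg_EFin; first exact: nearW.
  have -> : 0 = 0 `^ p^-1 :> R by rewrite powR0// invr_neq0// gt_eqF.
  apply: cvg_powR_nonneg => //; first by rewrite invr_gt0.
  by rewrite -(normr0 R); exact: cvg_norm.
apply: (@squeeze_cvge _ _ _ _ (fun=> 0%E) _ (fun N => (`|b N| `^ p^-1)%:E)) => //;
  last exact: cvg_cst.
exists 1%N => // N /= N1; rewrite Lnorm_ge0 /=.
have -> : Lnorm (P N) p%:E (fun w => (N%:R^-1 * log_partition beta (@J N) w - l)%:E) =
    ((\int[P N]_w (`|N%:R^-1 * log_partition beta (@J N) w - l| `^ p)%:E) `^ p^-1)%E.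
  by rewrite unlock.
rewrite -poweR_EFin; apply: gt0_ler_poweR.
- by rewrite invr_ge0 ltW.
- rewrite in_itv /= leey andbT; apply: integral_ge0 => w _.
  by rewrite lee_fin powR_ge0.
- by rewrite in_itv /= leey andbT lee_fin.
- by apply: le_trans (bound N N1) _; rewrite lee_fin ler_norm.
Qed.
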